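(* Let $1<p<\infty$, let $\mu,\lambda\in A_p(\mathbb{R}^n\times\mathbb{R}^n)$, and set $\nu=\mu^{1/p}\lambda^{-1/p}$. Then there is a constant $C$, depending only on $n$, $p$, $\mu$ and $\lambda$, such that for every $b\in bmo(\nu)$ $$\|b\|_{bmo(\nu)}\le C\sup_{1\le k,l\le n}\big\|[b,R^1_kR^2_l]\big\|_{L^p(\mu)\to L^p(\lambda)},$$ where $R^1_k$ and $R^2_l$ denote the $k$-th and $l$-th Riesz transforms on $\mathbb{R}^n$ acting in the first and in the second variable, respectively.
   Context: Points of $\mathbb{R}^n\times\mathbb{R}^n$ are $(x_1,x_2)$. A rectangle is $R=Q_1\times Q_2$ with $Q_1,Q_2\subset\mathbb{R}^n$ cubes with sides parallel to the axes; $\langle f\rangle_R=\frac1{|R|}\int_R f\,dx$. A weight is an a.e. positive locally integrable function; $w(R)=\int_R w\,dx$, $L^p(w)=L^p(w\,dx)$. $w\in A_p(\mathbb{R}^n\times\mathbb{R}^n)$ means $\sup_R\langle w\rangle_R\langle w^{1-p'}\rangle_R^{p-1}<\infty$, supremum over all rectangles, $1/p+1/p'=1$. $bmo(\nu)$ is the space of $b\in L^1_{loc}$ with $\|b\|_{bmo(\nu)}:=\sup_R\frac1{\nu(R)}\int_R|b-\langle b\rangle_R|\,dx<\infty$, supremum over all rectangles. $[b,T]f=b\,Tf-T(bf)$. *)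

(* Defs.v *)
From HB Require Import structures.
From mathcomp Require Import all_boot all_order all_algebra.
From mathcomp Require Import all_classical all_reals all_analysis.

Set Implicit Arguments.
Unset Strict Implicit.
Unset Printing Implicit Defensive.

Import Order.TTheory GRing.Theory Num.Theory.
Import numFieldNormedType.Exports.

Local Open Scope classical_set_scope.
Local Open Scope ring_scope.

Notation Rn R n := (n.-tuple (measurableTypeR R)).
Notation Rnn R n := (Rn R n * Rn R n)%type.

Section lebesgue_succ.
Variables (R : realType) (n : nat).
Variable m : {sigma_finite_measure set (Rn R n) -> \bar R}.

Definition Rn_cons (xt : measurableTypeR R * Rn R n) : Rn R n.+1 :=
  [tuple of xt.1 :: xt.2].

Lemma measurable_Rn_cons : measurable_fun setT Rn_cons.
Proof.
by apply: measurable_cons; [exact: measurable_fst|exact: measurable_snd].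
Qed.

Definition lebesgue_succ : set (Rn R n.+1) -> \bar R :=
  pushforward (lebesgue_measure \x m)%E Rn_cons.

HB.instance Definition _ := Measure.copy lebesgue_succ
  (measure_function_pushforward__canonical__measure_function_Measure
     (lebesgue_measure \x m)%E measurable_Rn_cons).

Lemma lebesgue_succ_sigma_finite : sigma_finite setT lebesgue_succ.
Proof.
have /sigma_finiteP[F [TF ndF Foo]] := sigma_finiteT (@lebesgue_measure R).
have /sigma_finiteP[G [TG ndG Goo]] := sigma_finiteT m.
pose g (x : Rn R n.+1) : measurableTypeR R * Rn R n :=
  (thead x, [tuple of behead x]).
have mg : measurable_fun setT g.
  apply/measurable_fun_pairP; split => /=; last exact: measurable_behead.
  exact: (measurable_tnth ord0).
have gK y : g (Rn_cons y) = y.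
  case: y => a t; rewrite /g /Rn_cons /= theadE; congr (_, _).
  exact/val_inj.
exists (fun i => g @^-1` (F i `*` G i)).
  rewrite -preimage_bigcup -[LHS](preimage_setT g); congr (g @^-1` _).
  rewrite -setXTT TF TG predeqE => -[x y]; split.
    move=> [/= [j _ Fjx] [k _ Gky]]; exists (maxn j k) => //; split.
    - by move: x Fjx; exact/subsetPset/ndF/leq_maxl.
    - by move: y Gky; exact/subsetPset/ndG/leq_maxr.
  by move=> [k _ []/= ? ?]; split; exists k.
move=> i; have [mF Fi] := Foo i; have [mG Gi] := Goo i; split.
  by rewrite -[X in measurable X]setTI; apply: mg => //; exact: measurableX.
rewrite /lebesgue_succ /pushforward -comp_preimage.
rewrite (_ : g \o Rn_cons = id); last by rewrite funeqE => y /=; rewrite gK.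
by rewrite preimage_id product_measure1E// lte_mul_pinfty// ge0_fin_numE.
Qed.

HB.instance Definition _ := @Measure_isSigmaFinite.Build _ _ _
  lebesgue_succ lebesgue_succ_sigma_finite.

End lebesgue_succ.

Fixpoint leb (R : realType) (n : nat) :
    {sigma_finite_measure set (Rn R n) -> \bar R} :=
  match n with
  | 0 => dirac [tuple]
  | n'.+1 => lebesgue_succ (leb R n')
  end.

Notation leb2 R n := (leb R n \x leb R n)%E.

(* All functions are real-valued and Borel; every Lebesgue measurable function
   coincides a.e. with a Borel one. *)
Section little_bmo.
Variables (R : realType) (n : nat).
Implicit Types (A : set (Rnn R n)) (f g b w nu mu lambda : Rnn R n -> R).

Definition eucl_dist (x y : Rn R n) : R :=
  Num.sqrt (\sum_(i < n) ((tnth x i : R) - (tnth y i : R)) ^+ 2).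

(* Equivalent, for closed sets, to compactness in [R^n * R^n]; tuples carry no
   topology in the library. *)
Definition Rnn_bounded A := exists r : R, forall x, A x ->
  eucl_dist x.1 [tuple of nseq n 0] <= r /\ eucl_dist x.2 [tuple of nseq n 0] <= r.

Definition loc_integrable f := measurable_fun setT f /\
  forall A, measurable A -> Rnn_bounded A ->
    (leb2 R n).-integrable A (EFin \o f).

(* closed cube with lower corner [a] and side length [l] *)
Definition cube (a : Rn R n) (l : R) : set (Rn R n) :=
  [set x | forall i, (tnth a i : R) <= tnth x i <= (tnth a i : R) + l].

Definition rectangle A := exists a1 l1 a2 l2,
  [/\ 0 < l1, 0 < l2 & A = cube a1 l1 `*` cube a2 l2].

(* The average is extended-real because [w^(1-p')] is not assumed locally
   integrable in the definition of [A_p]. *)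
Definition emean A f : \bar R :=
  ((\int[leb2 R n]_(x in A) (f x)%:E) / (leb2 R n) A)%E.

Definition mean A f : R := fine (emean A f).

Definition weight w := loc_integrable w /\ {ae leb2 R n, forall x, 0 < w x}.

Definition conj_exp (p : R) : R := p / (p - 1).

Definition Ap (p : R) w := weight w /\
  (ereal_sup [set emean A w *
                  emean A (fun x => w x `^ (1 - conj_exp p))%R `^ (p - 1)
             | A in rectangle] < +oo)%E.

Definition bmo_norm nu b : \bar R :=
  ereal_sup [set ((\int[leb2 R n]_(x in A) `|b x - mean A b|%:E) /
                  (\int[leb2 R n]_(x in A) (nu x)%:E))%E | A in rectangle].

Definition bmo nu b := loc_integrable b /\ (bmo_norm nu b < +oo)%E.

Definition bloom_weight (p : R) mu lambda : Rnn R n -> R :=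
  fun x => mu x `^ (p^-1) * lambda x `^ (- p^-1).

Definition Lp_norm (p : R) w f : \bar R :=
  ((\int[leb2 R n]_x (`|f x| `^ p * w x)%:E) `^ p^-1)%E.

Definition Gamma (a : R) : R :=
  \int[lebesgue_measure]_(t in `]0, +oo[) (t `^ (a - 1) * expR (- t)).

(* [c_n (x_k - y_k) / |x - y|^(n+1)], [c_n = Gamma((n+1)/2) / pi^((n+1)/2)] *)
Definition riesz_kernel (k : 'I_n) (x y : Rn R n) : R :=
  Gamma (n.+1%:R / 2) / (pi `^ (n.+1%:R / 2)) *
  (((tnth x k : R) - (tnth y k : R)) / eucl_dist x y ^+ n.+1).

Definition riesz_trunc (k : 'I_n) (e : R) (f : Rn R n -> R) : Rn R n -> R :=
  fun x => \int[leb R n]_(y in [set y | e < eucl_dist x y])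
             (riesz_kernel k x y * f y).

(* Pointwise principal value. It exists a.e. and is the bounded operator
   on [L^p(w)] when [f] is in [L^p(w)] with [w] in [A_p(R^n)]; points without
   a limit get the default value of [lim]. *)
Definition riesz (k : 'I_n) (f : Rn R n -> R) : Rn R n -> R :=
  fun x => lim (riesz_trunc k e f x @[e --> 0^'+]).

Definition riesz1 (k : 'I_n) f : Rnn R n -> R :=
  fun x => riesz k (fun y => f (y, x.2)) x.1.

Definition riesz2 (l : 'I_n) f : Rnn R n -> R :=
  fun x => riesz l (fun y => f (x.1, y)) x.2.

Definition commutator b (T : (Rnn R n -> R) -> Rnn R n -> R) f : Rnn R n -> R :=
  fun x => b x * T f x - T (fun y => b y * f y) x.

Definition bounded_compact_supp f := measurable_fun setT f /\
  (exists M : R, forall x, `|f x| <= M) /\ Rnn_bounded [set x | f x != 0].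

(* The norm [L^p(mu) -> L^p(lambda)] of an operator given on the dense subspace
   of bounded compactly supported functions, equivalently of its bounded
   extension to [L^p(mu)]. A commutator [[b, T]] is defined on that subspace:
   for [b] in [bmo nu] and [f] bounded with compact support, [f] is in
   [L^p(mu)] and [b f] is in [L^p(lambda)], so both terms make sense, while
   [T (b f)] need not for a general [f] in [L^p(mu)]. *)
Definition op_norm (p : R) mu lambda (S : (Rnn R n -> R) -> Rnn R n -> R) :
    \bar R :=
  ereal_sup [set Lp_norm p lambda (S f) | f in
    [set f | bounded_compact_supp f /\ (Lp_norm p mu f <= 1)%E]].

End little_bmo.

(* Main.v *)
Require Import Defs.
From mathcomp Require Import all_boot all_order all_algebra.
From mathcomp Require Import all_classical all_reals all_analysis.
From mathcomp Require Import measurable_realfun ring lra.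

Set Implicit Arguments.
Unset Strict Implicit.
Unset Printing Implicit Defensive.

Import Order.TTheory GRing.Theory Num.Theory.
Import numFieldNormedType.Exports.

Local Open Scope classical_set_scope.
Local Open Scope ring_scope.

(* Only one pair of Riesz transforms is needed. Given Q = Q1 x Q2, translate
   both cubes by minus twice their side lengths along the diagonal to get the
   rectangle Q'; on Q x Q' the kernel of R^1_k R^2_l is positive and comparable
   to 1/|Q|, and no principal value occurs. Let alpha be a median of b on Q' and
   E the half of Q' where b <= alpha. If b(x) >= alpha, then b(x) - b(y) >=
   b(x) - alpha for y in E, so |[b, T] 1_E (x)| dominates b(x) - alpha; the part
   of Q where b < alpha is symmetric. With S the rectangle containing Q and Q',
   Hoelder's inequality bounds the integral of |b - alpha| over Q by
   ||[b, T]|| mu(S)^(1/p) lambda^(1-p')(S)^(1/p'), and the A_p conditions on S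
   together with |Q|^2 <= nu(Q) nu^-1(Q) bound this by C ||[b, T]|| nu(Q). *)

(** * Integrals of nonmeasurable functions, medians *)

Section measure.
Context d (T : measurableType d) (R : realType).
Implicit Types (mu : {measure set T -> \bar R}) (A : set T).

(** The integral of a nonnegative function is a supremum over the simple functions below it, and
    enlarging the function enlarges that family. *)
Lemma le_integral_nonmeasurable mu (g h : T -> \bar R) :
  (forall x, 0 <= g x)%E -> (forall x, g x <= h x)%E ->
  (\int[mu]_x g x <= \int[mu]_x h x)%E.
Proof.
move=> g0 gh; have h0 x : (0 <= h x)%E by exact: le_trans (g0 x) (gh x).
rewrite !ge0_integralTE//; apply: ge_ereal_sup => _ [f /= fg <-].
by apply: ereal_sup_ubound; exists f => //= x; exact: le_trans (fg x) (gh x).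
Qed.

(* No measurability is required of [h]: a commutator, defined by pointwise limits,
   is not known to be measurable. *)
Lemma ae_le_integral_nonmeasurable mu (g h : T -> \bar R) :
  measurable_fun setT g -> (forall x, 0 <= g x)%E ->
  {ae mu, forall x, g x <= h x}%E ->
  (\int[mu]_x g x <= \int[mu]_x h x)%E.
Proof.
move=> mg g0 [N [mN N0 gh]].
have ghN x : ~ N x -> (g x <= h x)%E by move=> Nx; apply: contrapT => /gh.
rewrite [leRHS]integralE.
(* The negative part of [h] vanishes off the null set [N], so it lies below the function equal to
   +oo on [N] and 0 elsewhere, whose integral is 0. *)
have -> : (\int[mu]_x h^\- x = 0)%E.
  apply/eqP; rewrite eq_le integral_ge0 ?andbT//.
  apply: (@le_trans _ _ (\int[mu]_(x in N) +oo)%E); last first.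
    by rewrite integral_cst// N0 mule0.
  rewrite [leRHS]integral_mkcond; apply: le_integral_nonmeasurable => // x.
  rewrite patchE; case: ifPn => [_|]; first by rewrite leey.
  rewrite notin_setE => /ghN gx; rewrite funenegE ge_max lexx andbT.
  by rewrite leeNl oppe0; exact: le_trans gx.
rewrite sube0 (@ge0_negligible_integral _ _ _ mu setT N)//.
rewrite integral_mkcond; apply: le_integral_nonmeasurable => x.
  by rewrite patchE; case: ifPn.
rewrite patchE; case: ifPn => [|_]; last exact: funepos_ge0.
by rewrite inE => -[_ /ghN gx]; rewrite funeposE le_max gx.
Qed.

Lemma hoelder_in mu A (f g : T -> R) (p q : R) : measurable A ->
  measurable_fun setT f -> measurable_fun setT g ->
  (forall x, 0 <= f x) -> (forall x, 0 <= g x) ->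
  0 < p -> 0 < q -> p^-1 + q^-1 = 1 ->
  (\int[mu]_(x in A) (f x * g x)%:E <=
   (\int[mu]_(x in A) (f x `^ p)%:E) `^ p^-1 *
   (\int[mu]_(x in A) (g x `^ q)%:E) `^ q^-1)%E.
Proof.
move=> mA mf mg f0 g0 p0 q0 pq.
(* Extending by zero outside [A] does not change these integrals, because 0 to a positive power is
   0; this reduces the claim to the global inequality. *)
have E (h : T -> R) (r : R) : 0 < r -> (forall x, 0 <= h x) ->
    (\int[mu]_(x in A) (h x `^ r)%:E = \int[mu]_x (`|(h \_ A) x|%:E `^ r))%E.
  move=> r0 h0; rewrite integral_mkcond; apply: eq_integral => x _.
  rewrite !patchE; case: ifPn => _; first by rewrite ger0_norm.
  by rewrite normr0 poweR_EFin powR0// gt_eqF.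
have := @hoelder _ _ _ mu (f \_ A) (g \_ A) p q.
rewrite Lnorm1 unlock -!E//.
have -> : (\int[mu]_x `|((f \_ A \* g \_ A)%R x)%:E| =
           \int[mu]_(x in A) (f x * g x)%:E)%E.
  rewrite [RHS]integral_mkcond; apply: eq_integral => x _.
  rewrite /= !patchE; case: ifPn => _; first by rewrite ger0_norm// mulr_ge0.
  by rewrite mulr0 normr0.
by apply=> //; apply/(measurable_restrictT _ _).1 => //; exact: measurable_funTS.
Qed.

(** Continuity from above, available because [A] has finite measure. *)
Lemma half_measure_bigcap mu A (F : (set T)^nat) : (mu A < +oo)%E ->
  measurable A -> (forall n, measurable (F n)) -> (forall n, F n `<=` A) ->
  nonincreasing_seq F -> (forall n, mu A <= 2%:E * mu (F n))%E ->
  (mu A <= 2%:E * mu (\bigcap_n F n))%E.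
Proof.
move=> Aoo mA mF FA niF half.
have /(cvgeZl (y := 2%:E) isT) cF : mu \o F @ \oo --> mu (\bigcap_n F n).
  apply: nonincreasing_cvg_mu => //; last exact: bigcapT_measurable.
  by rewrite (le_lt_trans _ Aoo)// le_measure// inE.
rewrite -(cvg_lim _ cF)//.
by apply: lime_ge; [by apply/cvg_ex; eexists; exact: cF|exact: nearW].
Qed.

(** The median is the infimum of the set [S] of levels t with at least half of [A] in {b <= t}. If
    [S] were empty or unbounded below, the decreasing sets {b >= n} or {b <= -n} would each carry
    half of the mass while having empty intersection, against continuity from above. *)
Lemma exists_median mu A (b : T -> R) : measurable A -> (mu A < +oo)%E ->
  (0 < mu A)%E -> measurable_fun setT b ->
  exists a : R, (mu A <= 2%:E * mu (A `&` [set x | (b x <= a)%R]))%E /\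
                (mu A <= 2%:E * mu (A `&` [set x | (a <= b x)%R]))%E.
Proof.
move=> mA Aoo A0 mb.
have mle t : measurable (A `&` [set x | (b x <= t)%R]).
  apply: measurableI => //; rewrite -[X in measurable X]setTI.
  by rewrite (_ : [set x | _] = b @^-1` `]-oo, t]); [exact: mb|
    apply/seteqP; split=> x /=; rewrite in_itv].
have mge t : measurable (A `&` [set x | (t <= b x)%R]).
  apply: measurableI => //; rewrite -[X in measurable X]setTI.
  by rewrite (_ : [set x | _] = b @^-1` `[t, +oo[); [exact: mb|
    apply/seteqP; split=> x /=; rewrite in_itv/= andbT].
have Afin B : measurable B -> B `<=` A -> mu B \is a fin_num.
  by move=> mB BA; rewrite ge0_fin_numE// (le_lt_trans _ Aoo)// le_measure// inE.
have leS B C : measurable B -> measurable C -> B `<=` C ->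
    (mu A <= 2%:E * mu B -> mu A <= 2%:E * mu C)%E.
  move=> mB mC BC /le_trans; apply; apply: lee_wpmul2l => //.
  by rewrite le_measure// inE.
have no0 (F : (set T)^nat) : (forall n, measurable (F n)) ->
    (forall n, F n `<=` A) -> nonincreasing_seq F ->
    (forall n, mu A <= 2%:E * mu (F n))%E -> \bigcap_n F n !=set0.
  move=> mF FA niF half; apply/set0P/eqP => F0.
  have := half_measure_bigcap Aoo mA mF FA niF half.
  by rewrite F0 measure0 mule0 leNgt A0.
pose S := [set t | (mu A <= 2%:E * mu (A `&` [set x | (b x <= t)%R]))%E].
(* The two closed half-spaces at level t cover [A], so they cannot both carry less than half of
   it. *)
have compl t : ~ S t -> (mu A <= 2%:E * mu (A `&` [set x | (t <= b x)%R]))%E.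
  move=> /negP; rewrite -ltNge => St; rewrite leNgt; apply/negP => St'.
  have : (mu A <= mu (A `&` [set x | (b x <= t)%R]) +
                 mu (A `&` [set x | (t <= b x)%R]))%E.
    rewrite (le_trans _ (measureU2 _ _ _))// le_measure ?inE//.
      exact: measurableU.
    by move=> x Ax; have [] := leP (b x) t => [?|/ltW ?]; [left|right].
  move: St St'; rewrite -(fineK (Afin A _ _))//.
  rewrite -(fineK (Afin _ (mle t) (@subIsetl _ _ _))).
  rewrite -(fineK (Afin _ (mge t) (@subIsetl _ _ _))).
  by rewrite -!EFinM -!EFinD !lte_fin !lee_fin => h1 h2 h3; clear -h1 h2 h3; lra.
have S0 : S !=set0.
  apply: contrapT => /set0P/negP/negPn/eqP S0.
  have [] := @no0 (fun n => A `&` [set x | n%:R <= b x]) => //.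
  - move=> m n mn; apply/subsetPset; apply: setIS => x /=; apply: le_trans.
    by rewrite ler_nat.
  - by move=> n; apply: compl => Sn; have := S0;
      rewrite predeqE => /(_ n%:R)[/(_ Sn)].
  - move=> x /= xn; have [_] := xn (Num.truncn (b x)).+1 I.
    rewrite /= leNgt => /negP; apply.
    exact: Num.Theory.truncnS_gt.
have lbS : has_lbound S.
  apply: contrapT => nlb.
  have [] := @no0 (fun n => A `&` [set x | b x <= - n%:R]) => //.
  - move=> m n mn; apply/subsetPset; apply: setIS => x /= /le_trans; apply.
    by rewrite lerN2 ler_nat.
  - move=> n; apply: contrapT => Sn; apply: nlb; exists (- n%:R) => s Ss.
    rewrite leNgt; apply/negP => sn; apply: Sn; apply: leS Ss => //.
    by apply: setIS => x /= /le_trans; apply; exact: ltW.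
  - move=> x /= xn; have [_] := xn (Num.truncn (- b x)).+1 I.
    rewrite /= leNgt => /negP; apply.
    by rewrite ltrNl Num.Theory.truncnS_gt.
have infS : has_inf S by [].
exists (inf S); split.
- rewrite (_ : _ `&` _ = \bigcap_n (A `&` [set x | b x <= inf S + n.+1%:R^-1])).
    apply: half_measure_bigcap => //.
      move=> m n mn; apply/subsetPset; apply: setIS => x /= /le_trans; apply.
      by rewrite lerD2l lef_pV2 ?posrE// ler_nat.
    move=> n; have [|s Ss sn] := @inf_adherent _ S n.+1%:R^-1 _ infS; first by [].
    by apply: leS Ss => //; apply: setIS => x /= /le_trans; apply; exact: ltW.
  apply/seteqP; split=> [x [Ax /= bx] n _|x /= xn].
    by split=> //=; rewrite (le_trans bx)// lerDl.
  split; first by have [] := xn 0%N I.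
  by apply/ler_addgt0Pr => e e0; have [k ke] := ltr_add_invr e0;
    have [_ /= /le_trans] := xn k I; apply; rewrite lerD2l -[leLHS]add0r ltW.
(* Levels strictly below the infimum are outside [S], so [compl] applies to each of them; the limit
   is again continuity from above. *)
- rewrite (_ : _ `&` _ = \bigcap_n (A `&` [set x | (inf S - n.+1%:R^-1 <= b x)%R])).
    apply: half_measure_bigcap => //.
      move=> m n mn; apply/subsetPset; apply: setIS => x /=; apply: le_trans.
      by rewrite lerD2l lerN2 lef_pV2 ?posrE// ler_nat.
    move=> n; apply: compl => /(ge_inf lbS); rewrite leNgt => /negP; apply.
    by rewrite ltrBlDr ltrDl.
  apply/seteqP; split=> [x [Ax /= bx] n _|x /= xn].
    by split=> //=; rewrite (le_trans _ bx)// lerBlDr lerDl.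
  split; first by have [] := xn 0%N I.
  by apply/ler_addgt0Pr => e e0; have [k ke] := ltr_add_invr e0;
    have [_ /=] := xn k I; rewrite lerBlDr => /le_trans; apply;
    rewrite lerD2l -[leLHS]add0r ltW.
Qed.

(** The mean m satisfies |m - a| mu(A) <= int_A |b - a|, so replacing a by m in the triangle
    inequality at most doubles the oscillation. This allows a median to stand in for the mean. *)
Lemma mean_oscillation_le mu A (b : T -> R) (m a : R) : measurable A ->
  (mu A < +oo)%E -> mu.-integrable A (EFin \o b) ->
  (\int[mu]_(x in A) (b x)%:E = m%:E * mu A)%E ->
  (\int[mu]_(x in A) `|b x - m|%:E <= 2%:E * \int[mu]_(x in A) `|b x - a|%:E)%E.
Proof.
move=> mA Aoo ib bm.
have mb : measurable_fun A b by exact/measurable_EFinP/(measurable_int _ ib).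
have Afin : mu A \is a fin_num by rewrite ge0_fin_numE.
have ic c : mu.-integrable A (EFin \o cst c).
  by apply: measurable_bounded_integrable => //; exact: bounded_cst.
have H : (`|m - a|%:E * mu A <= \int[mu]_(x in A) `|b x - a|%:E)%E.
  have -> : (`|m - a|%:E * mu A = `|\int[mu]_(x in A) (b x - a)%:E|)%E.
    have -> : (\int[mu]_(x in A) (b x - a)%:E = (m - a)%:E * mu A)%E.
      rewrite EFinB muleBl// -bm -(integral_cst mu mA a%:E).
      exact: (integralB mA ib (ic a)).
    by rewrite abseM (gee0_abs (measure_ge0 mu A)).
  apply: (le_abse_integral mu mA).
  by apply/measurable_EFinP; exact: measurable_funB.
rewrite (@le_trans _ _ (\int[mu]_(x in A) (`|b x - a|%:E + `|m - a|%:E))%E)//.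
  apply: ge0_le_integral => //.
  - apply/measurable_EFinP/measurableT_comp => //; exact: measurable_funB.
  - apply: emeasurable_funD => //.
    by apply/measurable_EFinP/measurableT_comp => //; exact: measurable_funB.
  - move=> x _; rewrite -EFinD lee_fin.
    rewrite (_ : b x - m = (b x - a) - (m - a)); last by lra.
    exact: ler_normB.
rewrite ge0_integralD//.
- rewrite integral_cst//= [leRHS](_ : _ = (\int[mu]_(x in A) `|b x - a|%:E +
      \int[mu]_(x in A) `|b x - a|%:E)%E); first exact: leeD2l.
  by rewrite mule_natl mule2n.
- apply/measurable_EFinP/measurableT_comp => //; exact: measurable_funB.
Qed.

End measure.

(** * Cubes and the constant of the Riesz kernel *)

Section cubes.
Context {R : realType} {n : nat}.
Implicit Types (a x y : Rn R n) (l : R).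

Lemma measurable_cube a l : measurable (cube a l).
Proof.
rewrite (_ : cube a l = \bigcap_(i in [set: 'I_n])
   ((fun x : Rn R n => tnth x i) @^-1` `[tnth a i : R, tnth a i + l])).
  apply: fin_bigcap_measurable => // i _.
  by rewrite -[X in measurable X]setTI; apply: measurable_tnth.
apply/seteqP; split=> [x xa i _|x xa i] /=; first by rewrite in_itv/=; exact: xa.
by have := xa i I; rewrite /= in_itv.
Qed.

Lemma measurable_eucl_dist x : measurable_fun setT (eucl_dist x).
Proof.
apply: measurableT_comp; first exact: continuous_measurable_fun (@sqrt_continuous R).
apply: measurable_sum => i; apply: measurable_funX; apply: measurable_funB => //.
exact: measurable_tnth.
Qed.

Definition translate a l : Rn R n := [tuple (tnth a i : R) + l | i < n].

Lemma ler_coord_eucl_dist x y i : `|(tnth x i : R) - tnth y i| <= eucl_dist x y.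
Proof.
rewrite -sqrtr_sqr ler_wsqrtr// (bigD1 i)//= lerDl sumr_ge0// => j _.
exact: sqr_ge0.
Qed.

Lemma eucl_dist_le x y l : 0 <= l ->
  (forall i, `|(tnth x i : R) - tnth y i| <= l) ->
  eucl_dist x y <= Num.sqrt n%:R * l.
Proof.
move=> l0 xyl; rewrite -[l in leRHS](ger0_norm l0) -sqrtr_sqr -sqrtrM//.
rewrite ler_wsqrtr// mulr_natl -[n in leRHS]card_ord -sumr_const ler_sum// => i _.
by rewrite -real_normK ?num_real// lerXn2r ?nnegrE.
Qed.

End cubes.

Lemma leb_cube (R : realType) n (a : Rn R n) (l : R) : 0 <= l ->
  leb R n (cube a l) = (l ^+ n)%:E.
Proof.
move=> l0; elim: n a => [|n ih] a.
  rewrite /= diracE expr0 mem_set//; by case.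
rewrite /= /lebesgue_succ /pushforward /=.
rewrite (_ : _ @^-1` _ = `[tnth a ord0 : R, tnth a ord0 + l] `*`
    cube [tuple of behead a] l).
  rewrite product_measure1E//; last exact: measurable_cube.
  rewrite ih exprS EFinM; congr (_ * _)%E.
  apply: etrans (lebesgue_measure_itv `[tnth a ord0 : R, tnth a ord0 + l]) _.
  (* The length formula for an interval is a case distinction on 0 < l; in the degenerate case l = 0
     both sides are 0. *)
  rewrite /= lte_fin ltrDl -EFinB addrAC subrr add0r; case: ifPn => //.
  by rewrite -leNgt => l0'; congr EFin; apply/eqP; rewrite eq_le l0 l0'.
apply/seteqP; split=> -[t x] /=.
  move=> xa; split=> /=.
    by have := xa ord0; rewrite /Rn_cons in_itv/= tnth0.
  move=> i; have := xa (lift ord0 i); rewrite /Rn_cons/= tnthS tnth_behead.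
  by rewrite (_ : inord _ = lift ord0 i)//; apply/val_inj; rewrite /= inordK// ltnS.
move=> [/=]; rewrite in_itv/= => ta xa i.
case: (unliftP ord0 i) => [j ->|->]; rewrite /Rn_cons/= ?tnthS ?tnth0//.
have := xa j; rewrite tnth_behead.
by rewrite (_ : inord _ = lift ord0 j)//; apply/val_inj; rewrite /= inordK// ltnS.
Qed.

Lemma measurable_rectangle (R : realType) n (a1 a2 : Rn R n) (l1 l2 : R) :
  measurable (cube a1 l1 `*` cube a2 l2).
Proof. by apply: measurableX; exact: measurable_cube. Qed.

Lemma leb2_rectangle (R : realType) n (a1 a2 : Rn R n) (l1 l2 : R) :
  0 <= l1 -> 0 <= l2 ->
  leb2 R n (cube a1 l1 `*` cube a2 l2) = (l1 ^+ n * l2 ^+ n)%:E.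
Proof.
move=> l10 l20; rewrite product_measure1E; [|exact: measurable_cube..].
by rewrite EFinM; congr (_ * _)%E; exact: leb_cube.
Qed.

(** [Gamma] is the [fine] part of an extended integral and would be 0 if that integral were
    infinite, so finiteness is proved along with positivity. From below, the integrand is at least
    exp(-2) on [1, 2]; from above, it is dominated by a multiple of the exponential density of rate
    1/2. *)
Lemma Gamma_gt0 (R : realType) (a : R) : 1 <= a -> 0 < Gamma a.
Proof.
move=> a1; pose f (t : measurableTypeR R) : R := t `^ (a - 1) * expR (- t).
have mf : measurable_fun setT f.
  apply: measurable_funM; first exact: measurable_powR.
  by apply: measurableT_comp => //; exact: measurable_funN.
have f0 t : 0 <= f t by rewrite mulr_ge0 ?powR_ge0 ?expR_ge0.
have mE (D : set (measurableTypeR R)) : measurable_fun D (EFin \o f).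
  by apply/measurable_EFinP; exact: measurable_funTS.
rewrite /Gamma /Rintegral fine_gt0//; apply/andP; split.
- apply: (@lt_le_trans _ _ 
      (\int[@lebesgue_measure R]_(t in `[1%R, 2%R]) (expR (-2))%:E : \bar R)%E).
    rewrite integral_cst//= lebesgue_measure_itv/= lte_fin ltr1n.
    rewrite -EFinB -EFinM lte_fin.
    by rewrite mulr_gt0 ?expR_gt0//; lra.
  apply: (@le_trans _ _
      (\int[lebesgue_measure]_(t in `[1%R, 2%R]) (f t)%:E : \bar R)%E).
    apply: ge0_le_integral => //.
    move=> t /=; rewrite in_itv/= => /andP[t1 t2].
    rewrite lee_fin /f -[leLHS]mul1r ler_pM ?expR_ge0//.
        by rewrite -[leLHS](powRr0 t) ler_powR// subr_ge0.
      by rewrite ler_expR lerN2.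
  apply: ge0_subset_integral => //; first by move=> t _; rewrite lee_fin f0.
  by move=> t /=; rewrite !in_itv/= andbT => /andP[t1 _]; exact: lt_le_trans t1.
- pose m := (Num.truncn (a - 1)).+1.
  (* [M] is chosen so that t^(a-1) <= M exp(t/2): the summand 1 serves t <= 1, and for t > 1 one has
     t^(a-1) <= t^m together with (t/2)^m / m! <= exp(t/2). *)
  pose M : R := 1 + 2 ^+ m * m`!%:R.
  have M0 : 0 <= M by rewrite addr_ge0// mulr_ge0// exprn_ge0.
  have fM t : 0 < t -> f t <= (2 * M) * exponential_pdf 2^-1 t.
    move=> t0; rewrite exponential_pdfE ?(ltW t0)// mulrACA divff// mul1r.
    have -> : f t = (t `^ (a - 1) * expR (- (t / 2))) * expR (- 2^-1 * t).
      rewrite /f -mulrA -expRD; congr (_ * expR _); lra.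
    rewrite ler_wpM2r ?expR_ge0// expRN ler_pdivrMr ?expR_gt0//.
    have ht : 0 <= t / 2 by lra.
    have e1 : 1 <= expR (t / 2) by rewrite -[leLHS]expR0 ler_expR.
    have [t1|t1] := leP t 1.
      rewrite (@le_trans _ _ 1)//; last first.
        rewrite -[leLHS]mul1r ler_pM// lerDl mulr_ge0// exprn_ge0//.
      by rewrite -[leRHS](powRr0 t) ger_powR ?t0// subr_ge0.
    apply: (@le_trans _ _ (t ^+ m)).
      rewrite -powR_mulrn ?(ltW t0)// ler_powR ?(ltW t1)//.
      exact/ltW/Num.Theory.truncnS_gt.
    have := expR_ge1Dxn (Num.truncn (a - 1)) ht; rewrite -/m expr_div_n => e2.
    have e3 : t ^+ m / 2 ^+ m / m`!%:R <= expR (t / 2) by lra.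
    rewrite mulrDl mul1r -[leLHS]add0r lerD ?expR_ge0//.
    move: e3; rewrite ler_pdivrMr ?ltr0n ?fact_gt0// ler_pdivrMr ?exprn_gt0//.
    by move=> /le_trans; apply; rewrite le_eqVlt; apply/orP; left; apply/eqP; ring.
  apply: (@le_lt_trans _ _ (\int[lebesgue_measure]_t
      ((2 * M)%:E * (exponential_pdf 2^-1 t)%:E) : \bar R)%E).
    rewrite integral_mkcond; apply: le_integral_nonmeasurable => t.
      by rewrite patchE; case: ifPn => // _; rewrite lee_fin f0.
    rewrite patchE; case: ifPn => [|_].
      by rewrite inE/= in_itv/= andbT -EFinM lee_fin => /fM.
    by rewrite -EFinM lee_fin !mulr_ge0// exponential_pdf_ge0.
  rewrite ge0_integralZl//.
  + by rewrite integral_exponential_pdf// mule1 ltry.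
  + apply/measurable_EFinP; exact: measurable_exponential_pdf.
  + by move=> t _; rewrite lee_fin exponential_pdf_ge0.
  + by rewrite lee_fin mulr_ge0.
Qed.

(** * Riesz transforms away from the support *)

Definition riesz_cst (R : realType) (n : nat) : R :=
  Gamma (n.+1%:R / 2) / (pi `^ (n.+1%:R / 2)).

(** For points of a cube of side l and of its opposite cube, the numerator of the kernel is at least
    l and the distance at most 3 l sqrt(n); the quotient l / (3 l sqrt(n))^(n+1) leaves this
    constant divided by l^n. *)
Definition riesz_lower (R : realType) (n : nat) : R :=
  riesz_cst R n / (Num.sqrt n%:R * 3) ^+ n.+1.

Section riesz.
Context {R : realType} {n : nat}.
Implicit Types (a x y : Rn R n) (l : R) (k : 'I_n).

(** Once e <= d, the truncation removes only points where f vanishes, so the truncated integrals are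
    eventually constant and the limit exists trivially. *)
Lemma riesz_away k (f : Rn R n -> R) x (d : R) : 0 < d ->
  (forall y, eucl_dist x y <= d -> f y = 0) ->
  riesz k f x = \int[leb R n]_y (riesz_kernel k x y * f y).
Proof.
move=> d0 fd; apply/cvg_lim => //; apply: cvg_near_cst.
near=> e; rewrite /riesz_trunc Rintegral_mkcond; apply: eq_Rintegral => y _.
rewrite patchE; case: ifPn => //; rewrite notin_setE/= => /negP.
rewrite -leNgt => xy; rewrite fd ?mulr0//; apply: (le_trans xy).
by near: e; exact: nbhs_right_le.
Unshelve. all: by end_near. Qed.

Lemma measurable_riesz_kernel k x : measurable_fun setT (riesz_kernel k x).
Proof.
apply: measurable_funM => //; apply: measurable_funM.
  by apply: measurable_funB => //; exact: measurable_tnth.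
(* The inverse is rewritten as a real power to obtain measurability; on the diagonal both
   expressions take the value 0. *)
rewrite (_ : (fun y => (eucl_dist x y ^+ n.+1)^-1) =
  (fun y => (eucl_dist x y ^+ n.+1) `^ (-1))).
  apply: (@measurableT_comp _ _ _ _ _ _ (@powR R ^~ (-1))).
    exact: measurable_powR.
  by apply: measurable_funX; exact: measurable_eucl_dist.
by apply/funext => y; rewrite powR_inv1// exprn_ge0// sqrtr_ge0.
Qed.

Lemma riesz_cst_gt0 : (0 < n)%N -> 0 < riesz_cst R n.
Proof.
move=> n0; rewrite divr_gt0 ?powR_gt0 ?pi_gt0// Gamma_gt0//.
by rewrite ler_pdivlMr// mul1r ler_nat.
Qed.

(* With this translation every coordinate of [x - y], for [x] in the cube and [y]
   in the opposite cube, lies in [[l, 3l]]. *)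
Definition opposite_cube a l : set (Rn R n) := cube (translate a (- (2 * l))) l.

(** The smallest cube containing both the cube and its opposite cube: it starts at the lower corner
    of the latter and has three times the side. *)
Definition cube_hull a l : set (Rn R n) := cube (translate a (- (2 * l))) (3 * l).

Lemma cube_sub_hull a l : 0 < l -> cube a l `<=` cube_hull a l.
Proof.
move=> l0 x xa i; have /andP[h1 h2] := xa i; rewrite tnth_mktuple.
by apply/andP; split; lra.
Qed.

Lemma opposite_cube_sub_hull a l : 0 < l -> opposite_cube a l `<=` cube_hull a l.
Proof.
move=> l0 x xa i; have /andP[h1 h2] := xa i; rewrite h1/=.
by apply: (le_trans h2); rewrite lerD2l; lra.
Qed.

Lemma opposite_coord a l x y i : cube a l x -> opposite_cube a l y ->
  l <= (tnth x i : R) - tnth y i <= 3 * l.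
Proof.
move=> /(_ i) + /(_ i); rewrite tnth_mktuple => /andP[? ?] /andP[? ?].
by apply/andP; split; lra.
Qed.

Lemma opposite_eucl_dist_ge k a l x y : 0 < l ->
  cube a l x -> opposite_cube a l y -> l <= eucl_dist x y.
Proof.
move=> l0 xa ya; apply: le_trans (ler_coord_eucl_dist x y k).
by rewrite ler_normr; have /andP[-> _] := opposite_coord k xa ya.
Qed.

Lemma opposite_eucl_dist_le a l x y : 0 < l ->
  cube a l x -> opposite_cube a l y -> eucl_dist x y <= Num.sqrt n%:R * (3 * l).
Proof.
move=> l0 xa ya; apply: eucl_dist_le => [|i]; first by rewrite mulr_ge0// ltW.
have /andP[h1 h2] := opposite_coord i xa ya.
by rewrite ger0_norm// (le_trans _ h1)// ltW.
Qed.

Lemma riesz_lower_gt0 : (0 < n)%N -> 0 < riesz_lower R n.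
Proof.
move=> n0; rewrite divr_gt0 ?riesz_cst_gt0// exprn_gt0// mulr_gt0//.
by rewrite sqrtr_gt0 ltr0n.
Qed.

Lemma riesz_kernel_ge k a l x y : 0 < l ->
  cube a l x -> opposite_cube a l y ->
  riesz_lower R n / l ^+ n <= riesz_kernel k x y.
Proof.
move=> l0 xa ya; have n0 : (0 < n)%N := leq_ltn_trans (leq0n k) (ltn_ord k).
rewrite /riesz_lower /riesz_kernel -/(riesz_cst R n) -mulrA.
apply: ler_wpM2l; first exact/ltW/riesz_cst_gt0.
have /andP[h1 h2] := opposite_coord k xa ya.
have d0 := lt_le_trans l0 (opposite_eucl_dist_ge k l0 xa ya).
have -> : ((Num.sqrt n%:R * 3) ^+ n.+1)^-1 / l ^+ n =
    l / (Num.sqrt n%:R * (3 * l)) ^+ n.+1.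
  rewrite mulrA [in RHS]exprMn invfM [in RHS]mulrCA; congr (_ * _).
  by rewrite exprS invfM mulrA divff ?mul1r// gt_eqF.
rewrite ler_pM ?invr_ge0 ?exprn_ge0 ?mulr_ge0 ?sqrtr_ge0 ?(ltW l0)//.
rewrite lef_pV2 ?posrE ?exprn_gt0//.
  rewrite lerXn2r ?nnegrE ?(ltW d0) ?mulr_ge0 ?sqrtr_ge0 ?(ltW l0)//.
  by rewrite (opposite_eucl_dist_le l0 xa ya).
by rewrite !mulr_gt0// sqrtr_gt0 ltr0n.
Qed.

(** A boundedness statement for integrability and Fubini; its constant does not enter the final
    estimate. *)
Lemma riesz_kernel_le k a l x y : 0 < l ->
  cube a l x -> opposite_cube a l y ->
  `|riesz_kernel k x y| <= riesz_cst R n * (3 * l / l ^+ n.+1).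
Proof.
move=> l0 xa ya; have n0 : (0 < n)%N := leq_ltn_trans (leq0n k) (ltn_ord k).
have /andP[h1 h2] := opposite_coord k xa ya.
have d0 := opposite_eucl_dist_ge k l0 xa ya.
have dp := lt_le_trans l0 d0.
rewrite /riesz_kernel -/(riesz_cst R n) normrM (gtr0_norm (riesz_cst_gt0 n0)).
apply: ler_wpM2l; first exact/ltW/riesz_cst_gt0.
rewrite normrM normfV.
have e0 := exprn_gt0 n.+1 dp; have t0 := le_trans (ltW l0) h1.
rewrite (gtr0_norm e0) (ger0_norm t0); apply: ler_pM => //.
  by rewrite invr_ge0 ltW.
by rewrite lef_pV2 ?posrE ?exprn_gt0// lerXn2r// nnegrE ltW.
Qed.

End riesz.

(** * Commutators with positive kernels *)

Section kernel.
Context d (T : measurableType d) (R : realType).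
Implicit Types (mu : {measure set T -> \bar R}) (A E : set T).

Lemma integrable_bounded_kernel mu A (K f : T -> R) (C : R) :
  measurable_fun setT K -> (forall z, A z -> `|K z| <= C) ->
  mu.-integrable setT (EFin \o f) -> (forall z, ~ A z -> f z = 0) ->
  mu.-integrable setT (EFin \o (fun z => K z * f z)).
Proof.
move=> mK KC fi f0.
have mf : measurable_fun setT f by exact/measurable_EFinP/(measurable_int _ fi).
apply: (le_integrable measurableT _ _ (integrableZl measurableT C fi)).
  by apply/measurable_EFinP; exact: measurable_funM.
move=> z _ /=; rewrite lee_fin !normrM; have [/KC Kz|/f0->] := pselect (A z).
  by rewrite ler_wpM2r// (le_trans Kz)// ler_norm.
by rewrite normr0 !mulr0.
Qed.

Lemma integrable_indic_mul mu A E (b : T -> R) : measurable E -> E `<=` A ->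
  measurable A -> mu.-integrable A (EFin \o b) ->
  mu.-integrable setT (EFin \o (fun z => b z * \1_E z)).
Proof.
move=> mE EA mA bi.
have : mu.-integrable (setT `&` E) (EFin \o b).
  by rewrite setTI; exact: integrableS bi.
move=> /integrable_restrict-/(_ mE measurableT).
apply: eq_integrable => // z _; rewrite patchE/= indicE.
by case: (z \in E); rewrite ?mulr1 ?mulr0.
Qed.

(** By linearity the difference is the integral of K (B - b) s over [E]. There B - b has constant
    sign and size at least t, and K is at least c, so no cancellation occurs. *)
Lemma kernel_difference_ge mu A E (K b : T -> R) (c B s t : R) :
  measurable A -> (mu A < +oo)%E -> measurable E -> E `<=` A ->
  mu.-integrable A (EFin \o b) ->
  mu.-integrable setT (EFin \o (fun z => K z * (s * \1_E z))) ->
  mu.-integrable setT (EFin \o (fun z => K z * (b z * (s * \1_E z)))) ->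
  (forall z, A z -> c <= K z) -> 0 <= c -> 0 <= s -> 0 <= t ->
  (forall z, E z -> t <= B - b z) \/ (forall z, E z -> t <= b z - B) ->
  c * t * s * fine (mu E) <=
  `|B * (\int[mu]_z (K z * (s * \1_E z))) -
    \int[mu]_z (K z * (b z * (s * \1_E z)))|.
Proof.
move=> mA Aoo mE EA bi i1 i2 Kc c0 s0 t0 tB.
have i3 : mu.-integrable setT (EFin \o (fun z => B * (K z * (s * \1_E z)))).
  by have := integrableZl measurableT B i1; apply: eq_integrable.
rewrite -RintegralZl// -RintegralB//.
have Eoo : (mu E < +oo)%E by rewrite (le_lt_trans _ Aoo)// le_measure// inE.
have iE : mu.-integrable setT (EFin \o (fun z => c * t * s * \1_E z)).
  have := integrable_indic_mul mE EA mA
    (@measurable_bounded_integrable _ _ _ mu (cst (c * t * s)) A mA Aoo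
      (measurable_cst _) (bounded_cst _ _)).
  exact: eq_integrable.
rewrite (_ : c * t * s * fine (mu E) =
    \int[mu]_z (c * t * s * \1_E z)); last first.
  rewrite RintegralZl//; last first.
    have := integrable_indic_mul mE EA mA
      (@measurable_bounded_integrable _ _ _ mu (cst 1) A mA Aoo
        (measurable_cst _) (bounded_cst _ _)).
    by apply: eq_integrable => // z _ /=; rewrite mul1r.
  by rewrite /Rintegral integral_indic// setIT.
have i4 : mu.-integrable setT (EFin \o
    (fun z => B * (K z * (s * \1_E z)) - K z * (b z * (s * \1_E z)))).
  by have := integrableB measurableT i3 i2; apply: eq_integrable.
have pt z u : E z -> t <= u -> c * t * s * 1 <= u * (K z * (s * 1)).
  move=> Ez tu; rewrite !mulr1 (mulrC c) -!mulrA ler_pM// ?mulr_ge0//.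
  by rewrite ler_wpM2r// Kc//; exact: EA.
case: tB => tB.
- apply: le_trans (ler_norm _); apply: le_Rintegral => // z _.
  have [Ez|nEz] := pselect (E z); last by rewrite indicE memNset// !mulr0 subrr.
  have -> : \1_E z = 1 :> R by rewrite indicE mem_set.
  apply: le_trans (pt z _ Ez (tB z Ez)) _.
  by rewrite le_eqVlt; apply/orP; left; apply/eqP; ring.
(* When b - B >= t on [E] the integrand is nonpositive, so the same comparison is made for its
   negative. *)
- rewrite -normrN; apply: le_trans (ler_norm _).
  rewrite -mulN1r -RintegralZl//; apply: le_Rintegral => //.
    by have := integrableZl measurableT (-1) i4; apply: eq_integrable.
  move=> z _; have [Ez|nEz] := pselect (E z); last first.
    by rewrite indicE memNset// !mulr0 subrr mulr0.
  have -> : \1_E z = 1 :> R by rewrite indicE mem_set.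
  apply: le_trans (pt z _ Ez (tB z Ez)) _.
  by rewrite le_eqVlt; apply/orP; left; apply/eqP; ring.
Qed.

End kernel.

Section product_kernel.
Context d1 d2 (T1 : measurableType d1) (T2 : measurableType d2) (R : realType).
Variables (m1 : {sigma_finite_measure set T1 -> \bar R})
  (m2 : {sigma_finite_measure set T2 -> \bar R}).

(** Fubini's theorem. The kernels are bounded on the product set that carries f, which gives
    integrability of the product with one kernel and then with both. *)
Lemma iterated_product_kernel (A1 : set T1) (A2 : set T2)
    (K1 : T1 -> R) (K2 : T2 -> R) (C1 C2 : R) (f : T1 * T2 -> R) :
  measurable_fun setT K1 -> measurable_fun setT K2 ->
  (forall y, A1 y -> `|K1 y| <= C1) -> (forall y, A2 y -> `|K2 y| <= C2) ->
  (m1 \x m2)%E.-integrable setT (EFin \o f) ->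
  (forall z, ~ (A1 `*` A2) z -> f z = 0) ->
  (m1 \x m2)%E.-integrable setT (EFin \o (fun z => K1 z.1 * K2 z.2 * f z)) /\
  \int[m1]_y (K1 y * \int[m2]_y2 (K2 y2 * f (y, y2))) =
  \int[(m1 \x m2)%E]_z (K1 z.1 * K2 z.2 * f z).
Proof.
move=> mK1 mK2 bK1 bK2 fi f0.
pose G z := K2 z.2 * f z; pose H z := K1 z.1 * G z.
have HE : (fun z => K1 z.1 * K2 z.2 * f z) = H.
  by apply/funext => z; rewrite /H /G mulrA.
have G0 z : ~ (A1 `*` A2) z -> G z = 0 by move=> /f0 fz; rewrite /G fz mulr0.
have Gi : (m1 \x m2)%E.-integrable setT (EFin \o G).
  apply: (integrable_bounded_kernel (C := C2) _ _ fi f0).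
    exact: measurableT_comp.
  by move=> z [_ z2]; exact: bK2.
have Hi : (m1 \x m2)%E.-integrable setT (EFin \o H).
  apply: (integrable_bounded_kernel (C := C1) _ _ Gi G0).
    exact: measurableT_comp.
  by move=> z [z1 _]; exact: bK1.
rewrite HE; split=> //.
rewrite /Rintegral -(integral12_prod_meas1 Hi); congr fine.
apply: ae_eq_integral => //.
- apply/measurable_EFinP; apply: measurable_funM => //.
  apply: measurableT_comp; first exact: fine_measurable.
  exact: (measurable_fubini_F Gi).
- exact: measurable_fubini_F Hi.
(* Only almost every section is integrable; for those, K1 y can be moved out of the inner integral
   and the inner [fine] loses nothing. *)
- have := ae_integrable1 Gi; apply: filterS => y Gy _.
  rewrite /fubini_F /H/= -[RHS](_ : (\int[m2]_y2
    ((K1 y)%:E * (EFin \o G) (y, y2)))%E = _)//.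
  by rewrite integralZl// EFinM fineK//; exact: integrable_fin_num.
Qed.

End product_kernel.

Section double_riesz.
Context {R : realType} {n : nat}.
Variables (k1 k2 : 'I_n) (a1 a2 : Rn R n) (l1 l2 : R).
Hypotheses (l10 : 0 < l1) (l20 : 0 < l2).
Implicit Types (f g b : Rnn R n -> R) (x z : Rnn R n).

Let Q := cube a1 l1 `*` cube a2 l2.
Let Qt := opposite_cube a1 l1 `*` opposite_cube a2 l2.
Let n0 : (0 < n)%N := leq_ltn_trans (leq0n k1) (ltn_ord k1).

Definition riesz_kernel2 x z : R :=
  riesz_kernel k1 x.1 z.1 * riesz_kernel k2 x.2 z.2.

Lemma riesz_kernel2_ge x z : Q x -> Qt z ->
  riesz_lower R n ^+ 2 / (l1 ^+ n * l2 ^+ n) <= riesz_kernel2 x z.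
Proof.
move=> [x1 x2] [z1 z2].
have K1 := riesz_kernel_ge k1 l10 x1 z1; have K2 := riesz_kernel_ge k2 l20 x2 z2.
have h l : 0 < l -> 0 <= riesz_lower R n / l ^+ n.
  by move=> l0; apply/ltW; rewrite divr_gt0 ?exprn_gt0// riesz_lower_gt0.
rewrite [leLHS](_ : _ = (riesz_lower R n / l1 ^+ n) * (riesz_lower R n / l2 ^+ n)).
  by apply: ler_pM => //; exact: h.
by rewrite invfM expr2 mulrACA.
Qed.

(** Every section f(y, .) vanishes near x.2, so the inner transform at (y, x.2) is an absolutely
    convergent integral for each y. That integral is 0 for y near x.1, so the outer transform has no
    singularity either, and Fubini merges the two. *)
Lemma double_riesz_away x f : Q x ->
  (leb2 R n).-integrable setT (EFin \o f) -> (forall z, ~ Qt z -> f z = 0) ->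
  (leb2 R n).-integrable setT (EFin \o (fun z => riesz_kernel2 x z * f z)) /\
  riesz1 k1 (riesz2 k2 f) x = \int[leb2 R n]_z (riesz_kernel2 x z * f z).
Proof.
move=> [x1 x2] fi f0.
have [Hi HE] := iterated_product_kernel (measurable_riesz_kernel k1 x.1)
  (measurable_riesz_kernel k2 x.2) (fun y => riesz_kernel_le k1 l10 x1)
  (fun y => riesz_kernel_le k2 l20 x2) fi f0.
split=> //; rewrite -HE.
(* Opposite points are at distance at least the side length, so half of it is a safe radius. *)
have far1 y : eucl_dist x.1 y <= l1 / 2 -> ~ opposite_cube a1 l1 y.
  move=> xy /(opposite_eucl_dist_ge k1 l10 x1) /le_trans/(_ xy).
  by rewrite leNgt ltr_pdivrMr// ltr_pMr// ltr1n.
have far2 y : eucl_dist x.2 y <= l2 / 2 -> ~ opposite_cube a2 l2 y.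
  move=> xy /(opposite_eucl_dist_ge k2 l20 x2) /le_trans/(_ xy).
  by rewrite leNgt ltr_pdivrMr// ltr_pMr// ltr1n.
rewrite /riesz1 (_ : (fun y => _) =
    (fun y => \int[leb R n]_y2 (riesz_kernel k2 x.2 y2 * f (y, y2)))).
  rewrite (@riesz_away _ _ _ _ _ (l1 / 2))//; first by rewrite divr_gt0.
  move=> y /far1 ny.
  transitivity (\int[leb R n]_(y2 in setT) (0 : R)); last first.
    by rewrite Rintegral_cst// mul0r.
  by apply: eq_Rintegral => y2 _; rewrite f0 ?mulr0// => -[].
apply/funext => y; rewrite /riesz2 (@riesz_away _ _ _ _ _ (l2 / 2))//.
  by rewrite divr_gt0.
by move=> y2 /far2 ny2; apply: f0 => -[].
Qed.

Lemma commutator_away_ge b (t s : R) (E : set (Rnn R n)) x :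
  Q x -> measurable E -> E `<=` Qt ->
  (leb2 R n).-integrable Qt (EFin \o b) -> 0 <= t -> 0 <= s ->
  (forall z, E z -> t <= b x - b z) \/ (forall z, E z -> t <= b z - b x) ->
  riesz_lower R n ^+ 2 / (l1 ^+ n * l2 ^+ n) * t * s * fine (leb2 R n E) <=
  `|commutator b (fun f => riesz1 k1 (riesz2 k2 f)) (fun z => s * \1_E z) x|.
Proof.
move=> Qx mE EQ bi t0 s0 tb.
have mQ : measurable Qt by exact: measurable_rectangle.
have Qoo : (leb2 R n Qt < +oo)%E by rewrite leb2_rectangle ?ltry// ltW.
have nE z : ~ Qt z -> s * \1_E z = 0.
  by move=> nz; rewrite indicE memNset ?mulr0// => /EQ.
have ifn : (leb2 R n).-integrable setT (EFin \o (fun z => s * \1_E z)).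
  apply: (integrable_indic_mul mE EQ mQ).
  by apply: measurable_bounded_integrable => //; exact: bounded_cst.
have ibf : (leb2 R n).-integrable setT (EFin \o (fun z => b z * (s * \1_E z))).
  have := integrableZl measurableT s (integrable_indic_mul mE EQ mQ bi).
  by apply: eq_integrable => // z _ /=; rewrite -EFinM mulrCA.
have nbE z : ~ Qt z -> b z * (s * \1_E z) = 0 by move=> /nE ->; rewrite mulr0.
have [i1 e1] := double_riesz_away Qx ifn nE.
have [i2 e2] := double_riesz_away Qx ibf nbE.
rewrite /commutator e1 e2.
apply: (kernel_difference_ge mQ Qoo mE EQ bi i1 i2) => //.
  by move=> z; exact: riesz_kernel2_ge.
by rewrite divr_ge0 ?sqr_ge0 ?mulr_ge0 ?exprn_ge0//; exact: ltW.
Qed.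

End double_riesz.

(** * Weights *)

(** The third identity turns the p'-th power of w^(-1/p) into the dual weight w^(1-p'); the fourth
    is the exponent that appears on taking the p-th root of the A_p quantity. *)
Lemma conj_expE (R : realType) (p : R) : 1 < p ->
  [/\ 0 < conj_exp p, p^-1 + (conj_exp p)^-1 = 1,
      - p^-1 * conj_exp p = 1 - conj_exp p &
      (p - 1) * p^-1 = (conj_exp p)^-1].
Proof.
move=> p1; rewrite /conj_exp; have p0 : 0 < p by lra.
have q0 : 0 < p - 1 by lra.
by split; [rewrite divr_gt0|field; rewrite !gt_eqF|field; rewrite !gt_eqF|
  field; rewrite !gt_eqF].
Qed.

Section weights.
Context d (T : measurableType d) (R : realType).
Variable m : {measure set T -> \bar R}.
Implicit Types (w mu lambda : T -> R) (p : R) (A S : set T).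

Lemma measurable_fun_powR w (r : R) :
  measurable_fun setT w -> measurable_fun setT (fun x => w x `^ r).
Proof. exact: (@measurableT_comp _ _ _ _ _ _ (@powR R ^~ r)). Qed.

(** A weight is positive only almost everywhere; passing to its absolute value makes the facts on
    everywhere nonnegative integrands applicable. *)
Lemma ae_gt0_integral_norm A w : measurable A -> measurable_fun setT w ->
  {ae m, forall x, 0 < w x} ->
  (\int[m]_(x in A) (w x)%:E = \int[m]_(x in A) `|w x|%:E)%E.
Proof.
move=> mA mw w0; apply: ae_eq_integral => //.
- by apply/measurable_EFinP; exact: measurable_funTS.
- by apply/measurable_EFinP/measurableT_comp => //; exact: measurable_funTS.
- by apply: filterS w0 => x w0 _; rewrite gtr0_norm.
Qed.

Lemma ae_gt0_integral_ge0 A w : measurable A -> measurable_fun setT w ->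
  {ae m, forall x, 0 < w x} -> (0 <= \int[m]_(x in A) (w x)%:E)%E.
Proof.
move=> mA mw w0; rewrite ae_gt0_integral_norm//.
by apply: integral_ge0 => x _; rewrite lee_fin.
Qed.

Lemma ae_gt0_le_integral A S w : measurable A -> measurable S -> A `<=` S ->
  measurable_fun setT w -> {ae m, forall x, 0 < w x} ->
  (\int[m]_(x in A) (w x)%:E <= \int[m]_(x in S) (w x)%:E)%E.
Proof.
move=> mA mS AS mw w0.
rewrite (ae_gt0_integral_norm mA mw w0) (ae_gt0_integral_norm mS mw w0).
apply: ge0_subset_integral => //.
- by apply/measurable_EFinP/measurableT_comp => //; exact: measurable_funTS.
Qed.

(** A vanishing integral would force w = 0 almost everywhere on [A], and positivity would then make
    [A] null. *)
Lemma ae_gt0_integral_gt0 A w : measurable A -> measurable_fun setT w ->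
  {ae m, forall x, 0 < w x} -> (0 < m A)%E ->
  (0 < \int[m]_(x in A) (w x)%:E)%E.
Proof.
move=> mA mw w0 A0; rewrite lt0e ae_gt0_integral_ge0// andbT.
apply/negP => /eqP; rewrite ae_gt0_integral_norm// => i0.
have : ae_eq m A (EFin \o w) (cst 0%E).
  apply/(ae_eq_integral_abs m mA).
    by apply/measurable_EFinP; exact: measurable_funTS.
  exact: i0.
move=> ew; have [N [mN N0 AN]] := filterI w0 ew.
have : (m A <= m N)%E.
  apply: le_measure; rewrite ?inE// => x Ax; apply: AN => /= -[wx /(_ Ax)].
  by move=> [wx0]; rewrite wx0 ltxx in wx.
by rewrite N0 leNgt A0.
Qed.

(** Insert lambda^(1/p) lambda^(-1/p) = 1 and apply Hoelder: the first factor is dominated by the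
    L^p(lambda) norm of H through the pointwise bound, and the second is the dual weight. Here H
    stands for a commutator, with no measurability assumed. *)
Lemma testing_le A p lambda (g H : T -> R) (c : R) : measurable A -> 1 < p ->
  measurable_fun setT lambda -> {ae m, forall x, 0 < lambda x} ->
  measurable_fun setT g -> (forall x, 0 <= g x) -> 0 <= c ->
  (forall x, A x -> c * g x <= `|H x|) ->
  (c%:E * \int[m]_(x in A) (g x)%:E <=
   (\int[m]_x (`|H x| `^ p * lambda x)%:E) `^ p^-1 *
   (\int[m]_(x in A) (lambda x `^ (1 - conj_exp p))%:E) `^ (conj_exp p)^-1)%E.
Proof.
move=> mA p1 ml l0 mg g0 c0 cH; have p0 : 0 < p by lra.
have [q0 pq pE _] := conj_expE p1.
have mlp r : measurable_fun setT (fun x => lambda x `^ r).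
  exact: measurable_fun_powR.
have mgl : measurable_fun setT (fun x => c * g x * `|lambda x| `^ p^-1).
  apply: measurable_funM; first exact: measurable_funM.
  by apply: measurable_fun_powR; exact: measurableT_comp.
rewrite -ge0_integralZl//; last 2 first.
- by apply/measurable_EFinP; exact: measurable_funTS.
- by move=> x _; rewrite lee_fin.
apply: (@le_trans _ _ (\int[m]_(x in A)
    ((c * g x * `|lambda x| `^ p^-1) * lambda x `^ (- p^-1))%:E : \bar R)%E).
  apply: ae_ge0_le_integral => //.
  - by move=> x _; rewrite -EFinM lee_fin mulr_ge0.
  - by apply/measurable_EFinP/measurable_funM => //; exact: measurable_funTS.
  - by move=> x _; rewrite lee_fin !mulr_ge0 ?powR_ge0.
  - by apply/measurable_EFinP/measurable_funTS/measurable_funM.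
  - apply: filterS l0 => x lx _; rewrite -EFinM lee_fin -mulrA gtr0_norm//.
    by rewrite -powRD ?subrr ?powRr0 ?mulr1// lt0r_neq0// implybT.
apply: (le_trans (hoelder_in _ mA mgl (mlp (- p^-1)) _ _ p0 q0 pq)).
- by move=> x; rewrite !mulr_ge0 ?powR_ge0.
- by move=> x; rewrite powR_ge0.
apply: lee_pmul; rewrite ?poweR_ge0//.
- apply: gt0_ler_poweR; rewrite ?invr_ge0 ?(ltW p0)//.
  + by rewrite in_itv/= leey andbT; apply: integral_ge0 => x _;
      rewrite lee_fin powR_ge0.
  (* The integrand is known to be nonnegative only almost everywhere, so the sign of its integral
     also comes from the comparison lemma for nonmeasurable functions. *)
  + rewrite in_itv/= leey andbT -[leLHS](integral0 m setT).
    apply: ae_le_integral_nonmeasurable => //.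
    by apply: filterS l0 => x lx; rewrite lee_fin mulr_ge0 ?powR_ge0 ?ltW.
  rewrite integral_mkcond; apply: ae_le_integral_nonmeasurable.
  + apply/(measurable_restrictT _ mA).1/measurable_funTS/measurable_EFinP.
    exact: measurable_fun_powR.
  + by move=> x; rewrite patchE; case: ifPn => // _; rewrite lee_fin powR_ge0.
  + apply: filterS l0 => x lx; rewrite patchE; case: ifPn => [|_].
      rewrite inE => /cH cHx; rewrite lee_fin powRM ?powR_ge0 ?mulr_ge0//.
      rewrite -powRrM mulVf ?gt_eqF// powRr1// gtr0_norm// ler_pM2r//.
      by rewrite ge0_ler_powR ?(ltW p0)// nnegrE ?mulr_ge0.
    by rewrite lee_fin mulr_ge0 ?powR_ge0 ?ltW.
- by under eq_integral do rewrite -powRrM pE.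
Qed.

Lemma sqrt_cauchy_schwarz A (f g : T -> R) : measurable A ->
  measurable_fun setT f -> measurable_fun setT g ->
  (forall x, 0 <= f x) -> (forall x, 0 <= g x) ->
  ((\int[m]_(x in A) (f x `^ 2^-1 * g x `^ 2^-1)%:E) `^ 2 <=
   \int[m]_(x in A) (f x)%:E * \int[m]_(x in A) (g x)%:E)%E.
Proof.
move=> mA mf mg f0 g0.
have sqK (h : T -> R) : (forall x, 0 <= h x) ->
    (\int[m]_(x in A) ((h x `^ 2^-1) `^ 2)%:E = \int[m]_(x in A) (h x)%:E)%E.
  by move=> h0; apply: eq_integral => x _; rewrite -powRrM mulVf// powRr1.
have int_ge0 (h : T -> R) : (forall x, 0 <= h x) ->
    (0 <= \int[m]_(x in A) (h x)%:E)%E.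
  by move=> h0; apply: integral_ge0 => x _; rewrite lee_fin.
have h2 : (2^-1 + 2^-1 = 1 :> R) by lra.
have := hoelder_in m mA (measurable_fun_powR 2^-1 mf) (measurable_fun_powR 2^-1 mg)
  (fun x => powR_ge0 _ _) (fun x => powR_ge0 _ _) (ltr0n _ 2) (ltr0n _ 2) h2.
rewrite (sqK f f0) (sqK g g0) -poweRM ?int_ge0// => CS.
have := gt0_ler_poweR (ler0n _ 2) _ _ CS.
rewrite -poweRrM mulVf// poweRe1; last by rewrite mule_ge0// int_ge0.
apply; rewrite in_itv/= leey andbT ?poweR_ge0//.
by apply: int_ge0 => x; rewrite mulr_ge0 ?powR_ge0.
Qed.

Section bloom.
Variables (p : R) (mu lambda : T -> R).
Hypotheses (p1 : 1 < p) (mmu : measurable_fun setT mu)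
  (mlambda : measurable_fun setT lambda)
  (mu0 : {ae m, forall x, 0 < mu x}) (lambda0 : {ae m, forall x, 0 < lambda x}).

Let nu x := mu x `^ p^-1 * lambda x `^ (- p^-1).
(** The reciprocal of [nu], up to a null set. *)
Let eta x := lambda x `^ p^-1 * mu x `^ (- p^-1).

Let nu_ge0 x : 0 <= nu x. Proof. by rewrite mulr_ge0 ?powR_ge0. Qed.
Let eta_ge0 x : 0 <= eta x. Proof. by rewrite mulr_ge0 ?powR_ge0. Qed.
Let measurable_nu : measurable_fun setT nu.
Proof. by apply: measurable_funM; exact: measurable_fun_powR. Qed.
Let measurable_eta : measurable_fun setT eta.
Proof. by apply: measurable_funM; exact: measurable_fun_powR. Qed.

(** Since nu eta = 1 almost everywhere, m(A) is the integral of sqrt(nu) sqrt(eta) over [A]. *)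
Lemma bloom_cauchy_schwarz A : measurable A ->
  (m A `^ 2 <= \int[m]_(x in A) (nu x)%:E * \int[m]_(x in A) (eta x)%:E)%E.
Proof.
move=> mA; apply: le_trans (sqrt_cauchy_schwarz mA measurable_nu measurable_eta
  nu_ge0 eta_ge0).
apply: gt0_ler_poweR => //; rewrite ?in_itv/= ?leey ?andbT//.
  by apply: integral_ge0 => x _; rewrite lee_fin mulr_ge0 ?powR_ge0.
rewrite -[leLHS]mul1e -(integral_cst m mA); apply: ae_ge0_le_integral => //.
- by move=> x _; rewrite lee_fin mulr_ge0 ?powR_ge0.
- apply/measurable_EFinP/measurable_funTS.
  by apply: measurable_funM; exact: measurable_fun_powR.
- apply: filterS2 mu0 lambda0 => x mx lx _; rewrite lee_fin -powRM//.
  rewrite /nu /eta [X in (_ * X) `^ _]mulrC mulrACA.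
  rewrite -!powRD ?subrr ?addNr ?powRr0 ?mulr1 ?powR1//;
    by rewrite lt0r_neq0// implybT.
Qed.

Lemma bloom_hoelder A : measurable A ->
  (\int[m]_(x in A) (eta x)%:E <= (\int[m]_(x in A) (lambda x)%:E) `^ p^-1 *
    (\int[m]_(x in A) (mu x `^ (1 - conj_exp p))%:E) `^ (conj_exp p)^-1)%E.
Proof.
move=> mA; have p0 := lt_trans ltr01 p1.
have [q0 pq pE _] := conj_expE p1.
apply: le_trans (hoelder_in m mA _ _ _ _ p0 q0 pq) _.
- exact: measurable_fun_powR.
- exact: measurable_fun_powR.
- by move=> x; rewrite powR_ge0.
- by move=> x; rewrite powR_ge0.
under [X in (_ * X `^ _)%E]eq_integral do rewrite -powRrM pE.
rewrite le_eqVlt; apply/orP; left; apply/eqP; congr (_ `^ _ * _)%E.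
apply: ae_eq_integral => //.
- by apply/measurable_EFinP/measurable_funTS/measurable_fun_powR/measurable_fun_powR.
- by apply/measurable_EFinP/measurable_funTS.
- by apply: filterS lambda0 => x lx _; rewrite -powRrM mulVf ?gt_eqF// powRr1// ltW.
Qed.

(** Bound m(A)^2 by nu(A) eta(A), then eta(A) by eta(S), and eta(S) by Hoelder. The four resulting
    factors over [S] regroup, weight by weight, into the two A_p quantities assumed bounded. *)
Lemma bloom_le A S (Kmu Klambda : R) : measurable A -> measurable S -> A `<=` S ->
  0 <= Kmu -> 0 <= Klambda ->
  ((\int[m]_(x in S) (mu x)%:E) `^ p^-1 *
   (\int[m]_(x in S) (mu x `^ (1 - conj_exp p))%:E) `^ (conj_exp p)^-1
     <= Kmu%:E)%E ->
  ((\int[m]_(x in S) (lambda x)%:E) `^ p^-1 *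
   (\int[m]_(x in S) (lambda x `^ (1 - conj_exp p))%:E) `^ (conj_exp p)^-1
     <= Klambda%:E)%E ->
  ((\int[m]_(x in S) (mu x)%:E) `^ p^-1 *
   (\int[m]_(x in S) (lambda x `^ (1 - conj_exp p))%:E) `^ (conj_exp p)^-1 *
   m A `^ 2 <= (Kmu * Klambda)%:E * \int[m]_(x in A) (nu x)%:E)%E.
Proof.
move=> mA mS AS Kmu0 Klambda0 hmu hlambda.
have p0 := lt_trans ltr01 p1.
have [q0 pq pE _] := conj_expE p1.
have V0 : (0 <= \int[m]_(x in A) (nu x)%:E)%E.
  by apply: integral_ge0 => x _; rewrite lee_fin.
apply: (@le_trans _ _ ((\int[m]_(x in S) (mu x)%:E) `^ p^-1 *
   (\int[m]_(x in S) (lambda x `^ (1 - conj_exp p))%:E) `^ (conj_exp p)^-1 *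
   (\int[m]_(x in A) (nu x)%:E * ((\int[m]_(x in S) (lambda x)%:E) `^ p^-1 *
    (\int[m]_(x in S) (mu x `^ (1 - conj_exp p))%:E) `^ (conj_exp p)^-1)))%E).
  apply: lee_wpmul2l; first by rewrite mule_ge0 ?poweR_ge0.
  apply: le_trans (bloom_cauchy_schwarz mA) _; apply: lee_wpmul2l => //.
  apply: le_trans (bloom_hoelder mS).
  apply: ge0_subset_integral => //; last by move=> x _; rewrite lee_fin.
  by apply/measurable_EFinP/measurable_funTS.
rewrite muleCA [leRHS]muleC; apply: lee_wpmul2l => //.
rewrite EFinM [X in (_ * X <= _)%E]muleC muleACA [X in (_ * X <= _)%E]muleC.
by apply: lee_pmul; rewrite // mule_ge0 ?poweR_ge0.
Qed.

End bloom.
End weights.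

(** * Rectangles and the A_p condition *)

Section rectangles.
Context {R : realType} {n : nat}.
Implicit Types (a : Rn R n) (l : R) (A : set (Rnn R n)) (w b : Rnn R n -> R).

Lemma cube_bounded a l : 0 <= l -> exists r : R, forall x, cube a l x ->
  eucl_dist x [tuple of nseq n 0] <= r.
Proof.
move=> l0; pose M := \sum_(i < n) `|tnth a i : R| + l.
have M0 : 0 <= M by rewrite addr_ge0// sumr_ge0.
exists (Num.sqrt n%:R * M) => x xa; apply: eucl_dist_le => // i.
have /andP[h1 h2] := xa i.
have -> : tnth [tuple of nseq n 0] i = 0 :> R.
  by rewrite (tnth_nth 0) nth_nseq ltn_ord.
rewrite subr0 (_ : (tnth x i : R) = tnth a i + (tnth x i - tnth a i));
  last by rewrite addrC subrK.
rewrite (le_trans (ler_normD _ _))// lerD//.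
  by rewrite (bigD1 i)//= lerDl sumr_ge0.
by rewrite ger0_norm ?subr_ge0// lerBlDl.
Qed.

Lemma rectangle_bounded a1 a2 l1 l2 : 0 <= l1 -> 0 <= l2 ->
  Rnn_bounded (cube a1 l1 `*` cube a2 l2).
Proof.
move=> l10 l20; have [r1 h1] := cube_bounded a1 l10.
have [r2 h2] := cube_bounded a2 l20.
exists (Num.max r1 r2) => x [x1 x2]; split.
  by rewrite le_max h1.
by rewrite le_max h2// orbT.
Qed.

Lemma rectangle_measure_gt0 A : rectangle A ->
  exists2 r : R, 0 < r & leb2 R n A = r%:E.
Proof.
move=> [a1 [l1 [a2 [l2 [l10 l20 ->]]]]]; exists (l1 ^+ n * l2 ^+ n).
  by rewrite mulr_gt0 ?exprn_gt0.
by rewrite leb2_rectangle ?ltW.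
Qed.

Lemma rectangle_measurable A : rectangle A -> measurable A.
Proof. by move=> [a1 [l1 [a2 [l2 [_ _ ->]]]]]; exact: measurable_rectangle. Qed.

(** This is the p-th root of the A_p condition with the averages cleared: the volume factors
    |A|^(-1/p) and |A|^(-1/p') multiply to 1/|A|. *)
Lemma Ap_rectangle (p : R) w : 1 < p -> Ap p w -> exists2 K : R, 0 <= K &
  forall A, rectangle A ->
  ((\int[leb2 R n]_(x in A) (w x)%:E) `^ p^-1 *
   (\int[leb2 R n]_(x in A) (w x `^ (1 - conj_exp p))%:E) `^ (conj_exp p)^-1
   <= K%:E * leb2 R n A)%E.
Proof.
move=> p1 [[[mw _] w0]]; set B := ereal_sup _ => Boo.
have p0 : 0 < p by lra.
have [q0 pq _ pE] := conj_expE p1.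
have integral_w_ge0 A : rectangle A -> (0 <= \int[leb2 R n]_(x in A) (w x)%:E)%E.
  by move=> /rectangle_measurable mA; exact: ae_gt0_integral_ge0.
(* The maximum with 0 turns the supremum into a finite nonnegative number, so that [fine] preserves
   it. *)
exists (fine (maxe B 0) `^ p^-1); first exact: powR_ge0.
move=> A rA; have [r r0 Ar] := rectangle_measure_gt0 rA.
have BE : (emean A w * emean A (fun x => w x `^ (1 - conj_exp p))%R `^ (p - 1)
    <= (fine (maxe B 0))%:E)%E.
  rewrite fineK; last first.
    by rewrite ge0_fin_numE ?le_max ?lexx ?orbT// gt_max Boo ltry.
  by rewrite le_max ereal_sup_ubound//; exists A.
set I := (\int[_]_(x in A) (w x)%:E)%E in BE *.
set J := (\int[_]_(x in A) (w x `^ _)%:E)%E in BE *.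
have I0 : (0 <= I)%E by exact: integral_w_ge0.
have J0 : (0 <= J)%E by apply: integral_ge0 => x _; rewrite lee_fin powR_ge0.
move: BE; rewrite /emean -/I -/J Ar inver gt_eqF// => BE.
have rV0 : (0 <= r^-1%:E)%E by rewrite lee_fin invr_ge0 ltW.
have := gt0_ler_poweR (r := p^-1) _ _ _ BE.
rewrite invr_ge0 !in_itv/= !leey !andbT (ltW p0) => /(_ isT).
rewrite mule_ge0 ?mule_ge0 ?poweR_ge0// lee_fin fine_ge0 ?le_max ?lexx ?orbT//.
move=> /(_ isT isT).
rewrite !poweRM ?mule_ge0 ?poweR_ge0// -!poweRrM pE !poweR_EFin => h.
have rE : (r^-1 `^ p^-1 * r^-1 `^ (conj_exp p)^-1)%R = r^-1.
  by rewrite -powRD ?pq ?powRr1 ?invr_ge0 ?ltW// invr_eq0 (gt_eqF r0) implybT.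
rewrite -lee_pdivrMr// -rE EFinM muleACA; exact: h.
Qed.

End rectangles.

Section op_norm.
Context {R : realType} {n : nat}.
Variables (p : R) (mu lambda : Rnn R n -> R) (S : (Rnn R n -> R) -> Rnn R n -> R).

(** The zero function is admissible in the supremum, and [Lp_norm] is nonnegative on any image. *)
Lemma op_norm_ge0 : 0 < p -> (0 <= op_norm p mu lambda S)%E.
Proof.
move=> p0; apply: (@le_trans _ _ (Lp_norm p lambda (S (fun=> 0)))).
  exact: poweR_ge0.
apply: ereal_sup_ubound; exists (fun=> 0) => //=; split.
  split; first exact: measurable_cst.
  by split; [exists 0 => x; rewrite normr0|exists 0 => x /=; rewrite eqxx].
rewrite /Lp_norm integral0_eq ?poweR0r ?lee01// ?invr_eq0 ?gt_eqF// => x _.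
by rewrite normr0 powR0 ?mul0r// gt_eqF.
Qed.

End op_norm.

(** * The oscillation of b on a rectangle *)

Section oscillation.
Context {R : realType} {n : nat}.
Variables (p : R) (mu lambda b : Rnn R n -> R) (k1 k2 : 'I_n).
Hypotheses (p1 : 1 < p) (wmu : weight mu) (wlambda : weight lambda)
  (locb : loc_integrable b).
Variables (a1 a2 : Rn R n) (l1 l2 : R).
Hypotheses (l10 : 0 < l1) (l20 : 0 < l2).

Let T (f : Rnn R n -> R) := riesz1 k1 (riesz2 k2 f).
Let N := op_norm p mu lambda (commutator b T).
Let Q := cube a1 l1 `*` cube a2 l2.
Let Qt := opposite_cube a1 l1 `*` opposite_cube a2 l2.
Let S := cube_hull a1 l1 `*` cube_hull a2 l2.
Let X := ((\int[leb2 R n]_(x in S) (mu x)%:E) `^ p^-1 *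
  (\int[leb2 R n]_(x in S) (lambda x `^ (1 - conj_exp p))%:E) `^ (conj_exp p)^-1)%E.

(** The commutator is tested on the indicator of [E], normalised in L^p(mu). On [D] it dominates a
    multiple of |b - alpha|, which [testing_le] integrates; the normalisation costs mu(E)^(1/p) <=
    mu(S)^(1/p). *)
Lemma half_oscillation_le (alpha : R) (D E : set (Rnn R n)) :
  measurable D -> measurable E -> D `<=` Q -> E `<=` Qt ->
  (leb2 R n Qt <= 2%:E * leb2 R n E)%E ->
  (forall x z, D x -> E z -> `|b x - alpha| <= b x - b z) \/
  (forall x z, D x -> E z -> `|b x - alpha| <= b z - b x) ->
  ((riesz_lower R n ^+ 2 / 2)%:E * \int[leb2 R n]_(x in D) `|b x - alpha|%:E
    <= N * X)%E.
Proof.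
move=> mD mE DQ EQ Ehalf side.
have p0 := lt_trans ltr01 p1.
have [q0 pq _ _] := conj_expE p1.
have [[mmu locmu] mu0] := wmu; have [[mlambda loclambda] lambda0] := wlambda.
have [mb lb] := locb.
have mQt : measurable Qt by exact: measurable_rectangle.
have mS : measurable S by exact: measurable_rectangle.
have QtS : Qt `<=` S.
  by move=> x [/(opposite_cube_sub_hull l10) ? /(opposite_cube_sub_hull l20) ?].
have DS : D `<=` S.
  by move=> x /DQ [/(cube_sub_hull l10) ? /(cube_sub_hull l20) ?].
have QtE : leb2 R n Qt = (l1 ^+ n * l2 ^+ n)%:E by rewrite leb2_rectangle ?ltW.
have r0 : 0 < l1 ^+ n * l2 ^+ n by rewrite mulr_gt0 ?exprn_gt0.
have bndQt : Rnn_bounded Qt by apply: rectangle_bounded; exact: ltW.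
have bndE : Rnn_bounded E by have [r hr] := bndQt; exists r => x /EQ /hr.
have Eoo : (leb2 R n E < +oo)%E.
  apply: (@le_lt_trans _ _ (leb2 R n Qt)); last by rewrite QtE ltry.
  by apply: le_measure; rewrite ?inE.
pose e := fine (leb2 R n E).
have eE : leb2 R n E = e%:E by rewrite /e fineK// ge0_fin_numE.
have e_ge : l1 ^+ n * l2 ^+ n / 2 <= e.
  by rewrite ler_pdivrMr// [leRHS]mulrC; move: Ehalf; rewrite QtE eE -EFinM lee_fin.
have E0 : (0 < leb2 R n E)%E.
  by rewrite eE lte_fin; apply: lt_le_trans e_ge; rewrite divr_gt0.
have muE := locmu _ mE bndE.
pose u := fine (\int[leb2 R n]_(x in E) (mu x)%:E)%E.
have uE : (\int[leb2 R n]_(x in E) (mu x)%:E)%E = u%:E.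
  by rewrite /u fineK//; exact: integrable_fin_num.
have u0 : 0 < u by rewrite -lte_fin -uE; exact: ae_gt0_integral_gt0.
(* With u = mu(E), finite and positive, this factor gives s 1_E norm exactly 1 in L^p(mu). *)
pose s := u `^ (- p^-1).
have s0 : 0 < s by exact: powR_gt0.
pose f z := s * \1_E z.
have fN : (Lp_norm p lambda (commutator b T f) <= N)%E.
  apply: ereal_sup_ubound; exists f => //=; split; first split.
  - by apply: measurable_funM => //; exact: measurable_indic.
  - split.
      exists s => z; rewrite /f normrM gtr0_norm// ger_pMr// indicE.
      by case: (_ \in _); rewrite ?normr1 ?normr0.
    have [r hr] := bndE; exists r => z /= fz; apply: hr; apply: contrapT => nE.
    by move: fz; rewrite /f indicE memNset// mulr0 eqxx.
  - rewrite /Lp_norm [X in (X `^ _)%E](_ : _ =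
        (\int[leb2 R n]_(x in E) ((s `^ p)%:E * (mu x)%:E))%E).
      rewrite integralZl// uE -EFinM -powRrM mulNr mulVf ?gt_eqF//.
      by rewrite powR_inv1 ?(ltW u0)// mulVf ?gt_eqF// poweR_EFin powR1.
    rewrite [RHS]integral_mkcond; apply: eq_integral => z _.
    rewrite patchE /f indicE; case: ifPn => _; first by rewrite mulr1 gtr0_norm.
    by rewrite mulr0 normr0 powR0 ?mul0r// gt_eqF.
have N0 : (0 <= N)%E by apply: le_trans fN; exact: poweR_ge0.
pose g x := `|b x - alpha|.
have mg : measurable_fun setT g.
  by apply: measurableT_comp => //; exact: measurable_funB.
(* The kernel bound contributes the square over |Qt|, and |E| >= |Qt| / 2 leaves the factor 1/2. *)
pose c := riesz_lower R n ^+ 2 / 2 * s.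
have c0 : 0 <= c by rewrite mulr_ge0 ?(ltW s0)// divr_ge0// sqr_ge0.
have cH x : D x -> c * g x <= `|commutator b T f x|.
  move=> Dx; apply: le_trans (commutator_away_ge (t := g x) k1 k2 l10 l20
    (DQ _ Dx) mE EQ (lb _ mQt bndQt) _ (ltW s0) _); last 2 first.
  - by rewrite /g.
  - by case: side => h; [left|right] => z Ez; exact: h.
  rewrite -/e /c -mulrA [leRHS](_ : _ = riesz_lower R n ^+ 2 *
    (e / (l1 ^+ n * l2 ^+ n)) * (s * g x)); last first.
    by field; rewrite !gt_eqF// exprn_gt0.
  rewrite ler_wpM2r ?mulr_ge0 ?(ltW s0) ?normr_ge0// ler_wpM2l ?sqr_ge0//.
  by rewrite ler_pdivlMr// mulrC.
have main := testing_le mD p1 mlambda lambda0 mg (fun x => normr_ge0 _) c0 cH.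
set I := (\int[_]_(x in D) _)%E.
have I0 : (0 <= I)%E by apply: integral_ge0 => x _; rewrite lee_fin.
have sE : (u `^ p^-1 * s = 1)%R.
  by rewrite /s -powRD ?subrr ?powRr0// lt0r_neq0// implybT.
(* Multiplying by u^(1/p) s = 1 removes the normalisation from c and produces the factor
   mu(E)^(1/p). *)
have -> : ((riesz_lower R n ^+ 2 / 2)%:E * I = (u `^ p^-1)%:E * (c%:E * I))%E.
  by rewrite muleA -EFinM /c mulrCA sE mulr1.
rewrite /X [leRHS]muleCA; apply: lee_pmul.
- by rewrite lee_fin powR_ge0.
- by rewrite mule_ge0.
- rewrite -poweR_EFin -uE; apply: gt0_ler_poweR.
  + by rewrite invr_ge0 ltW.
  + by rewrite in_itv/= leey andbT ae_gt0_integral_ge0.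
  + by rewrite in_itv/= leey andbT ae_gt0_integral_ge0.
  + by apply: ae_gt0_le_integral => //; exact: subset_trans QtS.
- apply: le_trans main _; apply: lee_pmul; rewrite ?poweR_ge0//.
  have pw0 (A : set (Rnn R n)) :
      (0 <= \int[leb2 R n]_(x in A) (lambda x `^ (1 - conj_exp p))%:E)%E.
    by apply: integral_ge0 => x _; rewrite lee_fin powR_ge0.
  apply: gt0_ler_poweR.
  + by rewrite invr_ge0 ltW.
  + by rewrite in_itv/= leey andbT.
  + by rewrite in_itv/= leey andbT.
  + apply: ge0_subset_integral => //; last by move=> x _; rewrite lee_fin powR_ge0.
    by apply/measurable_EFinP/measurable_funTS/measurable_fun_powR.
Qed.

End oscillation.

(** With alpha a median of b on the opposite rectangle, the part of [Q] where b >= alpha is tested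
    against the half where b <= alpha, and the rest of [Q] against the other half. *)
Lemma median_oscillation_le (R : realType) (n : nat) (p : R)
    (mu lambda b : Rnn R n -> R) (k1 k2 : 'I_n) (a1 a2 : Rn R n) (l1 l2 : R) :
  1 < p -> weight mu -> weight lambda -> loc_integrable b -> 0 < l1 -> 0 < l2 ->
  let N := op_norm p mu lambda
    (commutator b (fun f => riesz1 k1 (riesz2 k2 f))) in
  let Q := cube a1 l1 `*` cube a2 l2 in
  let S := cube_hull a1 l1 `*` cube_hull a2 l2 in
  let X := ((\int[leb2 R n]_(x in S) (mu x)%:E) `^ p^-1 *
    (\int[leb2 R n]_(x in S) (lambda x `^ (1 - conj_exp p))%:E)
      `^ (conj_exp p)^-1)%E in
  exists alpha : R,
    ((riesz_lower R n ^+ 2 / 4)%:E * \int[leb2 R n]_(x in Q) `|b x - alpha|%:E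
      <= N * X)%E.
Proof.
move=> p1 wmu wlambda locb l10 l20 N Q S X.
pose Qt := opposite_cube a1 l1 `*` opposite_cube a2 l2.
have mb : measurable_fun setT b by case: locb.
have mQ : measurable Q by exact: measurable_rectangle.
have mQt : measurable Qt by exact: measurable_rectangle.
have QtE : leb2 R n Qt = (l1 ^+ n * l2 ^+ n)%:E by rewrite leb2_rectangle ?ltW.
have Qtoo : (leb2 R n Qt < +oo)%E by rewrite QtE ltry.
have Qt0 : (0 < leb2 R n Qt)%E by rewrite QtE lte_fin mulr_gt0 ?exprn_gt0.
have [alpha [hle hge]] := exists_median mQt Qtoo Qt0 mb; exists alpha.
have mle : measurable [set x | b x <= alpha].
  rewrite -[X in measurable X]setTI (_ : [set x | _] = b @^-1` `]-oo, alpha]).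
    exact: mb.
  by apply/seteqP; split=> x /=; rewrite in_itv.
have mge : measurable [set x | alpha <= b x].
  rewrite -[X in measurable X]setTI (_ : [set x | _] = b @^-1` `[alpha, +oo[).
    exact: mb.
  by apply/seteqP; split=> x /=; rewrite in_itv/= andbT.
have half D E := @half_oscillation_le R n p mu lambda b k1 k2 p1 wmu wlambda locb
  a1 a2 l1 l2 l10 l20 alpha D E.
have H1 := half (Q `&` [set x | alpha <= b x]) (Qt `&` [set x | b x <= alpha])
  (measurableI _ _ mQ mge) (measurableI _ _ mQt mle) (@subIsetl _ _ _)
  (@subIsetl _ _ _) hle.
have H2 := half (Q `\` [set x | alpha <= b x]) (Qt `&` [set x | alpha <= b x])
  (measurableD mQ mge) (measurableI _ _ mQt mge) (@subDsetl _ _ _)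
  (@subIsetl _ _ _) hge.
have QE : (\int[leb2 R n]_(x in Q) `|b x - alpha|%:E =
    \int[leb2 R n]_(x in Q `&` [set x | (alpha <= b x)%R]) `|b x - alpha|%:E +
    \int[leb2 R n]_(x in Q `\` [set x | (alpha <= b x)%R]) `|b x - alpha|%:E)%E.
  rewrite -{1}(setUIDK Q [set x | alpha <= b x]).
  apply: ge0_integral_setU => //.
  - exact: measurableI.
  - exact: measurableD.
  - apply/measurable_EFinP/measurable_funTS/measurableT_comp => //.
    exact: measurable_funB.
  - by apply/disj_setPS => x [[_ ?] [_ ?]].
have int_ge0 D : (0 <= \int[leb2 R n]_(x in D) `|b x - alpha|%:E)%E.
  by apply: integral_ge0 => x _; rewrite lee_fin.
(* The 4 is 2 times 2: one 2 from the half measure of the test set, the other from adding the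
   estimates for the two parts of [Q]. *)
rewrite (_ : riesz_lower R n ^+ 2 / 4 = 2^-1 * (riesz_lower R n ^+ 2 / 2));
  last by field.
rewrite EFinM -muleA lee_pdivrMl// mule_natl mule2n QE ge0_muleDr//; apply: leeD.
  apply: H1; left => x z [_ /= bx] [_ /= bz].
  by rewrite ger0_norm ?subr_ge0// lerD2l lerN2.
apply: H2; right => x z [_ /= /negP]; rewrite -ltNge => bx [_ /= bz].
by rewrite ltr0_norm ?subr_lt0// opprB lerD2r.
Qed.

(** * From oscillations on rectangles to the bmo norm *)

Theorem theorem1p3 (R : realType) (n : nat) (p : R) (mu lambda : Rnn R n -> R) :
  (0 < n)%N -> 1 < p -> Ap p mu -> Ap p lambda ->
  let nu := bloom_weight p mu lambda in
  exists C : R, 0 < C /\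
    forall b : Rnn R n -> R, bmo nu b ->
      (bmo_norm nu b <=
       C%:E * ereal_sup [set op_norm p mu lambda
                           (commutator b (fun f => riesz1 kl.1 (riesz2 kl.2 f)))
                        | kl in [set: 'I_n * 'I_n]])%E.
Proof.
move=> n0 p1 Amu Alambda nu.
have p0 : 0 < p by lra.
have [Kmu Kmu0 hmu] := Ap_rectangle p1 Amu.
have [Kla Kla0 hla] := Ap_rectangle p1 Alambda.
have [wmu _] := Amu; have [wla _] := Alambda.
have [[mmu _] mu0] := wmu; have [[mla _] la0] := wla.
pose k := riesz_lower R n ^+ 2 / 4.
have k0 : 0 < k by rewrite divr_gt0// exprn_gt0// riesz_lower_gt0.
(* |S| = 9^n |Q|, since the side is tripled in both copies of R^n. The A_p bound on [S] is used once
   for each weight, so the ratio enters squared. *)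
pose B : R := (Kmu * Kla) * (9 ^+ n) ^+ 2.
have B0 : 0 <= B by rewrite !mulr_ge0// sqr_ge0.
(* The 2 is the cost of replacing the median by the mean and 1/k that of the oscillation estimate;
   adding 1 ensures positivity, as B is only known to be nonnegative. *)
exists (2 * (k^-1 * B) + 1); split.
  by rewrite ltr_pwDr// !mulr_ge0// invr_ge0 ltW.
move=> b [locb _]; set sup := ereal_sup _.
pose kl : 'I_n * 'I_n := (Ordinal n0, Ordinal n0).
pose N := op_norm p mu lambda (commutator b (fun f => riesz1 kl.1 (riesz2 kl.2 f))).
have N0 : (0 <= N)%E by exact: op_norm_ge0.
have Nsup : (N <= sup)%E by apply: ereal_sup_ubound; exists kl.
have sup0 := le_trans N0 Nsup.
apply: ge_ereal_sup => _ [Q rQ <-].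
have [q q0 QE] := rectangle_measure_gt0 rQ.
have mQ := rectangle_measurable rQ.
have Qoo : (leb2 R n Q < +oo)%E by rewrite QE ltry.
have [a1 [l1 [a2 [l2 [l10 l20 Qdef]]]]] := rQ.
pose S := cube_hull a1 l1 `*` cube_hull a2 l2.
have rS : rectangle S.
  by do 4 eexists; split; last reflexivity; rewrite mulr_gt0.
have mS := rectangle_measurable rS.
have QS : Q `<=` S.
  rewrite Qdef => x [/(cube_sub_hull l10) ? /(cube_sub_hull l20) ?]; exact.
have SE : leb2 R n S = (9 ^+ n * q)%:E.
  move: QE; rewrite Qdef leb2_rectangle ?(ltW l10) ?(ltW l20)// => -[<-].
  rewrite leb2_rectangle ?mulr_ge0 ?(ltW l10) ?(ltW l20)// !exprMn.
  by rewrite mulrACA -exprMn (_ : 3 * 3 = 9 :> R)//; lra.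
pose V := (\int[leb2 R n]_(x in Q) (nu x)%:E)%E.
have nu_ge0 x : 0 <= nu x by rewrite mulr_ge0 ?powR_ge0.
have V0 : (0 <= V)%E by apply: integral_ge0 => x _; rewrite lee_fin.
have [alpha osc] := median_oscillation_le (Ordinal n0) (Ordinal n0) a1 a2 p1 wmu wla
  locb l10 l20.
move: osc; rewrite -/S -Qdef -/k; set X := ((\int[_]_(x in S) _) `^ _ * _)%E => osc.
have X0 : (0 <= X)%E by rewrite mule_ge0 ?poweR_ge0.
(* [bloom_le] bounds X |Q|^2 by Kmu Kla |S|^2 nu(Q); dividing by |Q|^2 leaves [B]. *)
have XV : (X <= B%:E * V)%E.
  have nn0 : 0 <= 9 ^+ n * q by rewrite mulr_ge0 ?exprn_ge0// ltW.
  have hmuS := hmu _ rS; have hlaS := hla _ rS.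
  rewrite SE -EFinM in hmuS; rewrite SE -EFinM in hlaS.
  have : (X * leb2 R n Q `^ 2 <=
      (Kmu * (9 ^+ n * q) * (Kla * (9 ^+ n * q)))%:E * V)%E.
    have h := bloom_le p1 mmu mla mu0 la0 mQ mS QS (mulr_ge0 Kmu0 nn0)
      (mulr_ge0 Kla0 nn0) hmuS hlaS.
    exact: h.
  rewrite QE poweR_EFin powR_mulrn ?(ltW q0)//.
  rewrite -lee_pdivlMr ?exprn_gt0// muleAC -EFinM.
  rewrite (_ : _ / q ^+ 2 = B)//; rewrite /B; field; exact: lt0r_neq0.
have osc2 : (\int[leb2 R n]_(x in Q) `|b x - mean Q b|%:E <=
    2%:E * \int[leb2 R n]_(x in Q) `|b x - alpha|%:E)%E.
  have ib : (leb2 R n).-integrable Q (EFin \o b).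
    apply: locb.2 => //; rewrite Qdef; apply: rectangle_bounded; exact: ltW.
  apply: mean_oscillation_le => //.
  rewrite /mean /emean QE inver gt_eqF//.
  rewrite -[X in fine (X * _)](fineK (integrable_fin_num mQ ib)) -EFinM/=.
  transitivity ((fine (\int[leb2 R n]_(x in Q) (b x)%:E) / q)%:E * q%:E)%E.
    by rewrite -EFinM divfK ?gt_eqF// fineK// (integrable_fin_num mQ ib).
  by congr (_ * _)%E; exact/esym.
have nu0 : {ae leb2 R n, forall x, 0 < nu x}.
  by apply: filterS2 mu0 la0 => x mx lx; rewrite mulr_gt0 ?powR_gt0.
have mnu : measurable_fun setT nu.
  by apply: measurable_funM; exact: measurable_fun_powR.
have Vpos : (0 < V)%E.
  have Q0 : (0 < leb2 R n Q)%E by rewrite QE lte_fin.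
  exact: ae_gt0_integral_gt0 Q0.
(* If nu(Q) = +oo, its inverse is 0, so the quotient is 0 and the bound follows from nonnegativity
   of the right-hand side. *)
rewrite -/V; move: XV Vpos V0; case: V => [v| |]//; last first.
  move=> _ _ _; rewrite invey mule0 mule_ge0// lee_fin addr_ge0//.
  by rewrite !mulr_ge0// invr_ge0 ltW.
move=> XV; rewrite !lte_fin => v0 _.
rewrite inver gt_eqF// lee_pdivrMr//; apply: (le_trans osc2).
have h1 : (\int[leb2 R n]_(x in Q) `|b x - alpha|%:E <= k^-1%:E * (N * X))%E.
  by rewrite -lee_pdivrMl ?invr_gt0// invrK.
apply: (@le_trans _ _ (2%:E * (k^-1%:E * (sup * (B%:E * v%:E))))%E).
  apply: lee_wpmul2l => //; apply: (le_trans h1).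
  apply: lee_wpmul2l; first by rewrite lee_fin invr_ge0 ltW.
  exact: lee_pmul.
rewrite (_ : 2%:E * _ = (2 * (k^-1 * B))%:E * sup * v%:E)%E; last first.
  by rewrite (EFinM 2) (EFinM k^-1) -!muleA (muleCA sup).
apply: lee_wpmul2r; first by rewrite lee_fin ltW.
by apply: lee_wpmul2r => //; rewrite lee_fin lerDl.
Qed.
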